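(* Let $\sigma$ be a triangulation of a polygon $P$ with $n\ge3$ vertices, with frozen Jacobian algebra $\Gamma_\sigma$ (an $R$-algebra via $x\mapsto C$). There is an isomorphism of $R$-orders $\Lambda\cong e_F\Gamma_\sigma e_F$ such that, regarding $e_F\Gamma_\sigma$ as a left $\Lambda$-module through it, for every edge $(P_s,P_t)$ of $\sigma$ with $1\le s<t\le n$ and the corresponding vertex $j$ of $Q_\sigma$, one has $e_F\Gamma_\sigma e_j\cong (s,t)$ as $\Lambda$-modules.
   Context: Let $K$ be a field, $R=K[x]$. Let $P$ be a regular polygon with vertices $P_1,\dots,P_n$ ($n\ge3$) labelled counterclockwise and $\sigma$ a triangulation (maximal set of pairwise non-crossing diagonals; edges of $\sigma$ = sides of $P$ and diagonals of $\sigma$; an edge joining $P_s,P_t$ is written $(P_s,P_t)$). The quiver $Q_\sigma$: vertices = edges of $\sigma$; internal arrow $a\to b$ whenever $a,b$ are sides of a common triangle and $a$ precedes $b$ anticlockwise around their common vertex; external arrow $a\to b$ between the two sides of $P$ at each vertex of $P$ incident to some diagonal, $a$ preceding $b$ anticlockwise. Minimal cycles: cyclic triangles (three internal arrows in a triangle) and big cycles (internal arrows and one external arrow around a vertex of $P$). $W_\sigma=\sum$cyclic triangles $-\sum$big cycles; $F$ = vertices corresponding to sides of $P$; $\Gamma_\sigma=KQ_\sigma/J$ with $J$ generated by cyclic derivatives $\partial_aW_\sigma$ for arrows $a$ with source or target not in $F$. $e_i$ = idempotent at vertex $i$, $e_F=\sum_{i\in F}e_i$. All minimal cycles through $i$ are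 equal in $\Gamma_\sigma$, with class $C_i$; $C=\sum_iC_i$, and $R$ acts via $x\mapsto C$. $\Lambda\subset M_n(K(x))$ is the tiled order with $(i,j)$ entry $x^{c_{ij}}R$, $c_{ij}=0$ for $i\le j$, $(i,j)\neq(1,n)$; $c_{1n}=-1$; $c_{ij}=1$ if $i=j+1$; $c_{ij}=2$ if $i\ge j+2$. For $1\le s<t\le n$, $(s,t)$ denotes the left $\Lambda$-module of column vectors $[R\cdots R\ (x)\cdots(x)\ (x^2)\cdots(x^2)]^t\subset K(x)^n$ with $s$ entries in $R$, then $t-s$ entries in $xR$, then $n-t$ entries in $x^2R$, with $\Lambda$ acting by matrix multiplication. *)

(* Defs.v *)
From HB Require Import structures.
From mathcomp Require Import all_boot all_order all_algebra.
From mathcomp Require Import fraction.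
Set Implicit Arguments. Unset Strict Implicit. Unset Printing Implicit Defensive.
Import Order.TTheory GRing.Theory Num.Theory.
Local Open Scope ring_scope.

(* Polygon vertices P_1..P_n are encoded as 0..n-1 : 'I_n (P_k <-> k-1),
   labelled counterclockwise.  An edge (P_s,P_t) with s<t is the pair (s-1,t-1). *)
Notation edge n := ('I_n * 'I_n)%type.

Definition is_side n (e : edge n) : bool :=
  (e.1 < e.2)%N && ((e.2 == e.1.+1 :> nat) || ((e.1 == 0 :> nat) && (e.2 == n.-1 :> nat))).
Definition is_diag n (e : edge n) : bool := (e.1 < e.2)%N && ~~ is_side e.
Definition crossing n (e f : edge n) : bool :=
  [&& (e.1 < f.1)%N, (f.1 < e.2)%N & (e.2 < f.2)%N] ||
  [&& (f.1 < e.1)%N, (e.1 < f.2)%N & (f.2 < e.2)%N].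
Definition triangulation n (sig : {set edge n}) : Prop :=
  [/\ forall e, e \in sig -> is_diag e,
      forall e f, e \in sig -> f \in sig -> ~~ crossing e f &
      forall e, is_diag e -> e \notin sig -> exists2 f, f \in sig & crossing e f].

Section Quiver.
Variables (n : nat) (sig : {set edge n}).

(* edges of sigma = vertices of Q_sigma *)
Definition is_edge (e : edge n) : bool := is_side e || (e \in sig).
Definition mkE (p q : 'I_n) : edge n := if (p < q)%N then (p, q) else (q, p).
Definition tri3 (p q r : 'I_n) : bool :=
  [&& p != q, q != r, p != r, is_edge (mkE p q), is_edge (mkE p r) & is_edge (mkE q r)].
(* anticlockwise "distance" from p to q: rays from P_p to later vertices rotate anticlockwise *)
Definition cdist (p q : 'I_n) : nat := ((q + n - p) %% n)%N.
Definition int_arrow (a b : edge n) : bool :=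
  [exists p : 'I_n, exists q : 'I_n, exists r : 'I_n,
    [&& a == mkE p q, b == mkE p r, tri3 p q r & (cdist p q < cdist p r)%N]].
Definition has_diag (p : 'I_n) : bool := [exists q : 'I_n, mkE p q \in sig].
Definition ext_arrow (a b : edge n) : bool :=
  [exists p : 'I_n, has_diag p && [exists q : 'I_n, exists r : 'I_n,
    [&& (q : nat) == ((p + n).-1 %% n)%N, (r : nat) == (p.+1 %% n)%N,
        a == mkE q p & b == mkE p r]]].
Definition arrow (a b : edge n) : bool := int_arrow a b || ext_arrow a b.

(* Q_sigma has no multiple arrows, so a path is its nonempty vertex sequence *)
Definition valid_path (p : seq (edge n)) : bool :=
  if p is x :: p' then is_edge x && path arrow x p' else false.

(* minimal cycles, as cyclic vertex lists [x1;...;xk] (arrows x_i -> x_{i+1}, x_k -> x_1) *)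
Definition tri_cycles : seq (seq (edge n)) :=
  [seq [:: mkE t.1.1 t.1.2; mkE t.1.1 t.2; mkE t.1.2 t.2]
  | t <- enum [pred t : 'I_n * 'I_n * 'I_n |
               (t.1.1 < t.1.2)%N && (t.1.2 < t.2)%N && tri3 t.1.1 t.1.2 t.2]].
Definition big_cycle (p : 'I_n) : seq (edge n) :=
  [seq mkE p q | q <- sort (fun q r => (cdist p q <= cdist p r)%N)
                         (enum [pred q : 'I_n | (q != p) && is_edge (mkE p q)])].
Definition big_cycles : seq (seq (edge n)) :=
  [seq big_cycle p | p <- enum [pred p : 'I_n | has_diag p]].

End Quiver.

Section PathAlgebra.
Variables (K : fieldType) (n : nat) (sig : {set edge n}).

Definition KQ := seq (K * seq (edge n)).
Definition wfKQ (u : KQ) : bool := all (fun c => valid_path sig c.2) u.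
Definition coef (u : KQ) (p : seq (edge n)) : K := \sum_(c <- u | c.2 == p) c.1.
Definition eqKQ (u v : KQ) : Prop := forall p, coef u p = coef v p.
Definition addKQ (u v : KQ) : KQ := u ++ v.
Definition scaleKQ (k : K) (u : KQ) : KQ := [seq (k * c.1, c.2) | c <- u].
Definition subKQ (u v : KQ) : KQ := u ++ scaleKQ (-1) v.
Definition pcomp (p q : seq (edge n)) : bool := last None (map Some p) == ohead q.
(* concatenation: p * q = first p then q *)
Definition mulKQ (u v : KQ) : KQ :=
  flatten [seq [seq (c.1 * d.1, c.2 ++ behead d.2) | d <- v & pcomp c.2 d.2] | c <- u].
Definition idem (v : edge n) : KQ := [:: (1, [:: v])].
Definition eF : KQ := [seq (1, [:: v]) | v <- enum [pred v : edge n | is_side v]].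

Definition pot : seq (K * seq (edge n)) :=
  [seq (1, c) | c <- tri_cycles sig] ++ [seq (-1, c) | c <- big_cycles sig].
Definition cyc_arrows (cv : seq (edge n)) : seq (edge n * edge n) := zip cv (rot 1 cv).
Definition dcyc (a : edge n * edge n) (cv : seq (edge n)) : KQ :=
  [seq (1, rot i.+1 cv) | i <- iota 0 (size cv) & nth a (cyc_arrows cv) i == a].
Definition dW (a : edge n * edge n) : KQ :=
  flatten [seq scaleKQ c.1 (dcyc a c.2) | c <- pot].
Definition rel_arrow (a : edge n * edge n) : bool :=
  arrow sig a.1 a.2 && ~~ (is_side a.1 && is_side a.2).
Definition inJ (u : KQ) : Prop :=
  exists l : seq (KQ * (edge n * edge n) * KQ),
    all (fun t => [&& wfKQ t.1.1, rel_arrow t.1.2 & wfKQ t.2]) l /\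
    eqKQ u (flatten [seq mulKQ (mulKQ t.1.1 (dW t.1.2)) t.2 | t <- l]).
(* equality in Gamma_sigma = KQ/J *)
Definition eqJ (u v : KQ) : Prop := inJ (subKQ u v).

Definition min_cycles_at (i : edge n) : seq (seq (edge n)) :=
  flatten [seq [seq rot k c ++ [:: i] | k <- iota 0 (size c) & nth i c k == i]
          | c <- tri_cycles sig ++ big_cycles sig].

Definition Kx := {fraction {poly K}}.
Definition toKx (p : {poly K}) : Kx := FracField.tofrac p.
Definition xKx : Kx := toKx 'X.
Definition cexp (i j : 'I_n) : int :=
  if (i <= j)%N then (if (i == 0 :> nat) && (j == n.-1 :> nat) then -1 else 0)
  else if (i == j.+1 :> nat) then 1 else 2.
Definition inLam (A : 'M[Kx]_n) : Prop :=
  forall i j, exists p : {poly K}, A i j = toKx p * xKx ^ cexp i j.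
(* the module (s,t) for the edge (a,b) = (P_{a+1},P_{b+1}) *)
Definition dexp (a b : nat) (i : 'I_n) : int :=
  if (i <= a)%N then 0 else if (i <= b)%N then 1 else 2.
Definition inST (a b : nat) (v : 'cV[Kx]_n) : Prop :=
  forall i, exists p : {poly K}, v i 0 = toKx p * xKx ^ dexp a b i.

(* psi : Lambda -> e_F Gamma e_F (on representatives) is an isomorphism of R-orders,
   where R = K[x] acts on Gamma by x |-> C (C e_i = any minimal cycle through i) *)
Definition Rorder_iso (psi : 'M[Kx]_n -> KQ) : Prop :=
  [/\ (forall A, inLam A -> wfKQ (psi A) /\ eqJ (psi A) (mulKQ (mulKQ eF (psi A)) eF)),
      (forall A B, inLam A -> inLam B -> eqJ (psi (A + B)) (addKQ (psi A) (psi B))),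
      (forall A B, inLam A -> inLam B -> eqJ (psi (A *m B)) (mulKQ (psi A) (psi B))),
      eqJ (psi 1%:M) eF &
      [/\ (forall (k : K) A, inLam A -> eqJ (psi (toKx k%:P *: A)) (scaleKQ k (psi A))),
          (forall i, is_side i -> forall m, m \in min_cycles_at i ->
             eqJ (mulKQ (psi (xKx *: 1%:M)) (idem i)) [:: (1, m)]),
          (forall A B, inLam A -> inLam B -> eqJ (psi A) (psi B) -> A = B) &
          (forall u, wfKQ u -> exists2 A, inLam A & eqJ (mulKQ (mulKQ eF u) eF) (psi A))]].

Definition in_eFGe (j : edge n) (u : KQ) : Prop :=
  wfKQ u /\ eqJ u (mulKQ (mulKQ eF u) (idem j)).
Definition Lmod_iso (psi : 'M[Kx]_n -> KQ) (j : edge n) (phi : KQ -> 'cV[Kx]_n) : Prop :=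
  [/\ (forall u v, in_eFGe j u -> in_eFGe j v -> eqJ u v -> phi u = phi v),
      (forall u, in_eFGe j u -> inST j.1 j.2 (phi u)),
      (forall u v, in_eFGe j u -> in_eFGe j v -> phi (addKQ u v) = phi u + phi v),
      (forall A u, inLam A -> in_eFGe j u -> phi (mulKQ (psi A) u) = A *m phi u) &
      [/\ (forall u v, in_eFGe j u -> in_eFGe j v -> phi u = phi v -> eqJ u v) &
          (forall w, inST j.1 j.2 w -> exists2 u, in_eFGe j u & phi u = w)]].

End PathAlgebra.

(* Main.v *)
(** Modulo J all arrows of a triangle and the arrows around a vertex of P can be traded for one
another, so a path of Q_sigma starting at the side [P_i, P_(i+1)] is equivalent to
  (walk along the sides to the one at P_s) . (turn around P_s up to the edge [P_s, P_t]) . C^k.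
A weight of arrows, additive and equal to 1 on every minimal cycle, is invariant under the
relations and recovers k.  Hence e_(side i) Gamma e_j is free of rank one over K[x], generated in
the weight of its canonical path, and these weights are the exponents defining (s,t) and Lambda
(up to conjugation by diag(1,...,1,x)).  Concretely, both isomorphisms are read off the polynomials
EV a b u = sum of c x^(weight p) over the terms c p of u with p a path from a to b. *)
Require Import Defs.
From HB Require Import structures.
From mathcomp Require Import all_boot all_order all_algebra.
From mathcomp Require Import fraction.
From mathcomp Require Import zify.
From Stdlib Require ClassicalEpsilon.
Set Implicit Arguments. Unset Strict Implicit. Unset Printing Implicit Defensive.
Import Order.TTheory GRing.Theory Num.Theory.

(** The polygon is cyclic, while a normal form needs a linear order. Labels therefore live in the
    universal cover: for walks starting at the side [i,i+1], every edge has exactly one lift [s,t]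
    with i <= s < t < i + n. An arrow either increases a label of this lift or carries it out of the
    window, and leaving the window costs exactly one factor C. The quotient u %/ n counts passages
    of the base point, and the weight of a walk is the difference of the potential u %/ n + v %/ n
    of lifted edges [u,v]. The side [P_n,P_1] lifts to labels n-1 and n and starts with potential 1
    instead of 0; this is the origin of [closing], of the matrix diag(1,...,1,x) and of the entry -1
    in the corner of Lambda. Elements of Gamma are available only through representatives, so
    everything about them rests on two facts: the polynomials [EV] vanish on J ([EV_inJ], [EV_dW]),
    and on combinations of paths starting at sides they separate classes modulo J ([eqJ_of_EV]). *)

Lemma mkE_sym n (p q : 'I_n) : mkE p q = mkE q p.
Proof.
by rewrite /mkE; case: ltngtP => // h; rewrite (val_inj h).
Qed.

(** * Edges of a triangulation in cyclic labels *)

Section CyclicLabels.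
Variables (n : nat) (sig : {set edge n}).
Hypothesis (n_gt2 : 2 < n).

Lemma n_gt0 : 0 < n. Proof. exact: ltn_trans n_gt2. Qed.

(* Polygon vertices are labelled by all natural numbers, u and u + n being the same vertex. *)
Definition vtx (u : nat) : 'I_n := Ordinal (ltn_pmod u n_gt0).
Definition seg (u v : nat) : edge n := mkE (vtx u) (vtx v).
Definition edg (u v : nat) : bool := is_edge sig (seg u v).

Lemma vtxDn u : vtx (u + n) = vtx u.
Proof. by apply: val_inj; rewrite /= modnDr. Qed.

Lemma vtxDMn u k : vtx (u + k * n) = vtx u.
Proof. by apply: val_inj; rewrite /= addnC modnMDl. Qed.

Lemma vtx_ord (i : 'I_n) : vtx i = i.
Proof. by apply: val_inj; rewrite /= modn_small. Qed.

Lemma vtx_inj u v : u <= v < u + n -> vtx u = vtx v -> u = v.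
Proof.
move=> /andP[uv vun] /(congr1 val) /= /eqP h.
rewrite eq_sym eqn_mod_dvd // in h.
have : v - u < n by lia.
case: (posnP (v - u)) => [|v0]; first by lia.
by move=> lt; move: (dvdn_leq v0 h); lia.
Qed.

Lemma segC u v : seg u v = seg v u. Proof. exact: mkE_sym. Qed.
Lemma segDl u v : seg (u + n) v = seg u v. Proof. by rewrite /seg vtxDn. Qed.
Lemma segDr u v : seg u (v + n) = seg u v. Proof. by rewrite /seg vtxDn. Qed.
Lemma edgC u v : edg u v = edg v u. Proof. by rewrite /edg segC. Qed.
Lemma edgDl u v : edg (u + n) v = edg u v. Proof. by rewrite /edg segDl. Qed.
Lemma edgDr u v : edg u (v + n) = edg u v. Proof. by rewrite /edg segDr. Qed.

(** After translation by a multiple of n, a window of n consecutive labels starts below n and hence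
    stays below 2n. There this case distinction replaces modular arithmetic and leaves goals for
    [lia]. *)
Lemma val_vtx u : u < n + n -> val (vtx u) = if u < n then u else u - n.
Proof.
move=> h /=; case: ltnP => un; first by rewrite modn_small.
by rewrite -[in LHS](subnK un) modnDr modn_small //; lia.
Qed.

Lemma seg1E u v : (seg u v).1 = if vtx u < vtx v then vtx u else vtx v.
Proof. by rewrite /seg /mkE; case: ifP. Qed.
Lemma seg2E u v : (seg u v).2 = if vtx u < vtx v then vtx v else vtx u.
Proof. by rewrite /seg /mkE; case: ifP. Qed.

Lemma edg_side u : edg u u.+1.
Proof.
rewrite /edg /is_edge /is_side.
rewrite (divn_eq u n) addnC -addSn /seg !vtxDMn -/(seg _ _) seg1E seg2E.
have un : u %% n < n by rewrite ltn_mod n_gt0.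
set m := u %% n in un *.
have h1 : val (vtx m) = m by rewrite val_vtx ?un //; lia.
have h2 : val (vtx m.+1) = if m.+1 < n then m.+1 else m.+1 - n by rewrite val_vtx //; lia.
apply/orP; left; move: h1 h2; move: (vtx m) (vtx m.+1) => x y /= h1 h2.
by case: ifP => c; case: ifP h2 => c' h2; rewrite ?h1 ?h2 in c *; lia.
Qed.

Lemma seg_shift p k u v : seg (p + k * n + u) (p + k * n + v) = seg (p + u) (p + v).
Proof. by rewrite /seg ![p + k * n + _]addnAC !vtxDMn. Qed.

Hypothesis tri : triangulation sig.

Lemma edge_ltn e : is_edge sig e -> e.1 < e.2.
Proof.
by case/orP => [/andP[]//|]; case: tri => h _ _ /h /andP[].
Qed.

Lemma edge_nocross e f : is_edge sig e -> is_edge sig f -> ~~ crossing e f.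
Proof.
move=> he hf; have := edge_ltn he; have := edge_ltn hf.
case: tri => _ h _; case/orP: he => [|he].
  rewrite /is_side /crossing => /andP[_ se]; have := ltn_ord f.1; have := ltn_ord f.2.
  by lia.
case/orP: hf => [|hf]; last by move=> _ _; apply: h.
rewrite /is_side /crossing => /andP[_ se]; have := ltn_ord e.1; have := ltn_ord e.2.
by lia.
Qed.

Lemma edg_neq u v : edg u v -> vtx u != vtx v.
Proof. by move/edge_ltn; rewrite seg1E seg2E; case: eqP => // ->; rewrite ltnn. Qed.

(** [crossing] compares labels linearly; here the order is cyclic. Interleaving of two chords
    survives rotation, so it is enough to move u below n and follow which of the other labels wrap
    around. *)
Lemma edg_nocross u v w z : u < v -> v < w -> w < z -> z < u + n ->
  edg u w -> edg v z -> False.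
Proof.
rewrite (divn_eq u n) addnC.
have un : u %% n < n by rewrite ltn_mod n_gt0.
move: (u %% n) (u %/ n) un => u0 k un uv vw wz zu.
have [a Ea] : exists a, v = u0 + k * n + a by exists (v - (u0 + k * n)); lia.
have [b Eb] : exists a, w = u0 + k * n + a by exists (w - (u0 + k * n)); lia.
have [c Ec] : exists a, z = u0 + k * n + a by exists (z - (u0 + k * n)); lia.
have {1}-> : u0 + k * n = u0 + k * n + 0 by rewrite addn0.
rewrite /edg Ea Eb Ec !seg_shift => h1 h2; move: (edge_nocross h1 h2).
have va : vtx (u0 + 0) = u0 :> nat by rewrite addn0 val_vtx ?un //; lia.
have := @val_vtx (u0 + a); have := @val_vtx (u0 + b); have := @val_vtx (u0 + c).
have := edge_ltn h1; have := edge_ltn h2.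
rewrite /crossing !seg1E !seg2E.
move: (vtx _) (vtx _) (vtx (_ + b)) (vtx (_ + c)) va => /= x y z' w' va; rewrite va.
by do 5![case: ifP=> ?]; lia.
Qed.

(** Maximality of the triangulation yields a diagonal crossing [p,q]; its ends are lifted to the
    window above p and named so that v is the end between p and q. *)
Lemma edg_max p q : p < q < p + n -> ~~ edg p q ->
  exists v z, [/\ p < v, v < q, q < z, z < p + n & edg v z].
Proof.
rewrite (divn_eq p n) addnC.
have un : p %% n < n by rewrite ltn_mod n_gt0.
move: (p %% n) (p %/ n) un => u0 k un /andP[pq qp].
have [a Ea] : exists a, q = u0 + k * n + a by exists (q - (u0 + k * n)); lia.
have {1}-> : u0 + k * n = u0 + k * n + 0 by rewrite addn0.
rewrite /edg {1}Ea seg_shift negb_or.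
set e := seg _ _ => /andP[ns nsig].
have va : vtx (u0 + 0) = u0 :> nat by rewrite addn0 val_vtx ?un //; lia.
have vb := @val_vtx (u0 + a).
have de : is_diag e.
  rewrite /is_diag ns andbT /e seg1E seg2E.
  move: (vtx _) (vtx (_ + a)) va vb => /= x y va vb.
  by case: ifP => //; case: ifP vb; lia.
case: tri => _ _ /(_ e de nsig) [f fs cf].
have lf : f.1 < f.2 by apply: edge_ltn; rewrite /is_edge fs orbT.
have ef : is_edge sig (f.1, f.2) by rewrite -surjective_pairing /is_edge fs orbT.
(* The label of the vertex m in the window from [u0 + 1] to [u0 + n]. The last value belongs to [u0]
   itself, which is no end of a diagonal crossing [e]. *)
pose lift (m : nat) := if u0 < m then m else m + n.
have vl (m : 'I_n) : vtx (lift m + k * n) = m.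
  by rewrite vtxDMn /lift; case: ifP => _; rewrite ?vtxDn vtx_ord.
have ff : edg (lift f.1 + k * n) (lift f.2 + k * n).
  by rewrite /edg /seg !vl /mkE lf.
have := ltn_ord f.1; have := ltn_ord f.2.
have : [&& u0 < lift f.1, u0 < lift f.2, lift f.1 < u0 + n, lift f.2 < u0 + n &
   (lift f.1 < u0 + a) && (u0 + a < lift f.2) || (lift f.2 < u0 + a) && (u0 + a < lift f.1)].
  have := ltn_ord f.1; have := ltn_ord f.2.
  move: cf va vb lf; rewrite /crossing /e seg1E seg2E {de e ns nsig ff vl fs ef}.
  move: (vtx _) (vtx (_ + a)) f.1 f.2 => /= x y f1 f2 cf va vb lf l1 l2.
  move: cf; rewrite /lift va; do 2!case: ifP; case: ifP; case: ifP vb; lia.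
move: ff; move: (lift f.1) (lift f.2) => x y ff.
case/and5P=> h1 h2 h3 h4 /orP[] /andP[h5 h6] _ _.
  by exists (x + k * n), (y + k * n); split=> //; clear -Ea h1 h2 h3 h4 h5 h6; lia.
exists (y + k * n), (x + k * n).
by split; rewrite 1?segC //; clear -Ea h1 h2 h3 h4 h5 h6; lia.
Qed.

(** If [z,z'] were missing, some edge [v,w] would have v strictly between z and z'. According as w
    lies before, after or at q + n, that edge crosses [q,z'], crosses [q,z], or is an edge at q
    between two consecutive ones. *)
Lemma edg_fan q z z' : q < z -> z < z' -> z' < q + n -> edg q z -> edg q z' ->
  (forall y, z < y < z' -> ~~ edg q y) -> edg z z'.
Proof.
move=> qz zz' z'q e1 e2 h; apply/negPn/negP => ne.
have [|v [w [zv vz' z'w wz ev]]] := edg_max _ ne; first by lia.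
case: (ltngtP w (q + n)) => c.
- by apply: (@edg_nocross q v z' w) => //; lia.
- apply: (@edg_nocross q (w - n) z v) => //; try lia.
  by rewrite edgC -edgDr subnK //; lia.
- by move: ev; rewrite c edgDr edgC; apply/negP/h; rewrite zv.
Qed.

(** The apex is the last neighbour of p before q: it and q are consecutive at p, so [edg_fan] gives
    the third side. *)
Lemma edg_apex p q : p.+1 < q -> q < p + n -> edg p q ->
  exists r, [/\ p < r, r < q, edg p r & edg r q].
Proof.
move=> pq qp e.
have ex : exists r, (p < r < q) && edg p r by exists p.+1; rewrite edg_side andbT; lia.
have ub r : (p < r < q) && edg p r -> r <= q by lia.
case: (ex_maxnP ex ub) => r /andP[/andP[pr rq] er] mx.
exists r; split=> //; apply: (@edg_fan p) => // y /andP[ry yq].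
by apply/negP => ey; have := mx y; rewrite ey yq (ltn_trans pr ry) => /(_ isT); lia.
Qed.
End CyclicLabels.

(** * Walks, weights and fans *)

Section Walks.
Variables (n : nat) (sig : {set edge n}).
Notation arr := (edge n * edge n)%type.

(** Listing arrows instead of vertices makes composition plain concatenation and the weight
    additive. The empty list is then a walk at every vertex, so the start is a separate argument. *)
Fixpoint walk (x : edge n) (w : seq arr) : bool :=
  if w is a :: w' then [&& a.1 == x, arrow sig a.1 a.2 & walk a.2 w'] else true.
Definition wend (x : edge n) (w : seq arr) : edge n := last x (map snd w).

Lemma wend_cat x a b : wend x (a ++ b) = wend (wend x a) b.
Proof. by rewrite /wend map_cat last_cat. Qed.

Lemma walk_cat x a b : walk x (a ++ b) = walk x a && walk (wend x a) b.
Proof. by elim: a x => //= c a IH x; rewrite IH !andbA. Qed.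

(* An arrow has weight 1 when it passes the base point between P_n and P_1: lifting a fan around q
   to the labels a <= b of the universal cover, its weight is b %/ n - a %/ n (see wt_fan). *)
Definition wt1 (x y : edge n) : nat := ~~ ((x.1 <= y.1) && (x.2 <= y.2)).
Definition wt (w : seq arr) : nat := \sum_(a <- w) wt1 a.1 a.2.

Lemma wt_cat a b : wt (a ++ b) = wt a + wt b.
Proof. by rewrite /wt big_cat. Qed.
Lemma wt_cons x y w : wt ((x, y) :: w) = wt1 x y + wt w.
Proof. by rewrite /wt big_cons. Qed.
Lemma wt_nil : wt [::] = 0.
Proof. by rewrite /wt big_nil. Qed.

Definition wpow (w : seq arr) k : seq arr := iter k (cat w) [::].

Lemma wpow_wt w k : wt (wpow w k) = k * wt w.
Proof. by elim: k => [|k IH]; rewrite ?wt_nil //= wt_cat IH mulSn. Qed.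

Lemma walk_wpow x w k : walk x w -> wend x w = x -> walk x (wpow w k) /\ wend x (wpow w k) = x.
Proof.
move=> h e; elim: k => [|k [IH1 IH2]] //=.
by rewrite walk_cat wend_cat h e IH1 IH2.
Qed.
End Walks.

Section Fans.
Variables (n : nat) (sig : {set edge n}) (n_gt2 : 2 < n).
Notation vtx := (vtx n_gt2).
Notation seg := (seg n_gt2).
Notation edg := (edg sig n_gt2).
Notation arr := (edge n * edge n)%type.

Definition fan (q a b : nat) : seq arr :=
  pairmap pair (seg q a) [seq seg q c | c <- iota a.+1 (b - a) & edg q c].

(* From the side [q-1,q] to the side [q,q+1]; q - 1 is written q + n.-1. *)
Definition turn (q : nat) : seq arr :=
  if has_diag sig (vtx q) then [:: (seg (q + n.-1) q, seg q q.+1)]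
  else [:: (seg (q + n.-1) q, seg (q + n.-1) q.+1); (seg (q + n.-1) q.+1, seg q q.+1)].

(** Turning at the vertices a, ..., b - 1 leads from the side [a-1,a] to the side [b-1,b]; hence the
    shifts by one in [walk_sides] and [can]. *)
Definition sides (a b : nat) : seq arr := flatten [seq turn c | c <- iota a (b - a)].

Lemma fan_nil q a : fan q a a = [::].
Proof. by rewrite /fan subnn. Qed.

Lemma fan_cat q a b c : a <= b -> b <= c -> edg q b -> fan q a b ++ fan q b c = fan q a c.
Proof.
move=> ab bc eb; rewrite /fan.
have -> : c - a = (b - a) + (c - b) by lia.
rewrite iotaD filter_cat map_cat pairmap_cat; congr (_ ++ _).
have -> : a.+1 + (b - a) = b.+1 by lia.
congr (pairmap pair _ _).
have [->|ab'] : a = b \/ a < b by lia.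
  by rewrite subnn.
have -> : b - a = (b - a).-1 + 1 by lia.
rewrite iotaD filter_cat map_cat last_cat /=.
have -> : a.+1 + (b - a).-1 = b by lia.
by rewrite eb.
Qed.

Lemma fan_step q a b : a < b -> edg q b -> (forall y, a < y < b -> ~~ edg q y) ->
  fan q a b = [:: (seg q a, seg q b)].
Proof.
move=> ab eb h; rewrite /fan.
have -> : b - a = (b - a).-1 + 1 by lia.
rewrite iotaD filter_cat.
have -> : a.+1 + (b - a).-1 = b by lia.
rewrite /= eb (@eq_in_filter _ _ pred0) ?filter_pred0 // => y.
by rewrite mem_iota => hy; apply: negbTE; apply: h; lia.
Qed.

Lemma fan_cons q a b : a < b -> edg q b -> exists z,
  [/\ a < z, z <= b, edg q z, (forall y, a < y < z -> ~~ edg q y) &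
      fan q a b = (seg q a, seg q z) :: fan q z b].
Proof.
move=> ab eb.
have ex : exists z, (a < z <= b) && edg q z by exists b; rewrite eb ab leqnn.
case: (ex_minnP ex) => z /andP[/andP[az zb] ez] mn.
have h y : a < y < z -> ~~ edg q y.
  by move=> hy; apply/negP => ey; have := mn y; rewrite ey andbT; lia.
exists z; split=> //.
by rewrite -(@fan_cat q a z b) ?(ltnW az) // (fan_step az).
Qed.

Lemma fanDl q a b : fan (q + n) a b = fan q a b.
Proof.
rewrite /fan segDl (eq_filter (edgDl _ _ q)).
by congr (pairmap _ _ _); apply: eq_map => c; rewrite segDl.
Qed.

Lemma fanDr q a b : fan q (a + n) (b + n) = fan q a b.
Proof.
rewrite /fan segDr subnDr -addSn addnC iotaDl filter_map -map_comp.
rewrite (eq_filter (a2 := edg q)); last by move=> c /=; rewrite addnC edgDr.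
by congr (pairmap _ _ _); apply: eq_map => c /=; rewrite addnC segDr.
Qed.

Lemma turnD q : turn (q + n) = turn q.
Proof.
rewrite /turn vtxDn -!addSn.
have -> : q + n + n.-1 = q + n.-1 + n by lia.
by rewrite !segDl !segDr.
Qed.

Lemma sides_nil a : sides a a = [::].
Proof. by rewrite /sides subnn. Qed.

Lemma sides_cat a b c : a <= b -> b <= c -> sides a b ++ sides b c = sides a c.
Proof.
move=> ab bc; rewrite /sides.
have -> : c - a = (b - a) + (c - b) by lia.
by rewrite iotaD map_cat flatten_cat subnKC.
Qed.

Lemma sides1 a : sides a a.+1 = turn a.
Proof. by rewrite /sides subSnn /= cats0. Qed.

Lemma sidesS a b : a <= b -> sides a b.+1 = sides a b ++ turn b.
Proof. by move=> ab; rewrite -(@sides_cat a b) ?sides1. Qed.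

Lemma cdist_vtx p q : p <= q < p + n -> cdist (vtx p) (vtx q) = q - p.
Proof.
move=> /andP[pq qp].
rewrite /cdist /= (divn_eq p n) in pq qp *.
have p0 : p %% n < n by rewrite ltn_mod (n_gt0 n_gt2).
rewrite addnC in pq qp *.
move: (p %% n) (p %/ n) p0 pq qp => u k un pq qp.
have -> : q = u + k * n + (q - (u + k * n)) by lia.
have : q - (u + k * n) < n by lia.
move: (q - _) => d dn; rewrite addKn.
rewrite ![u + k * n + _]addnAC ![_ + k * n]addnC !modnMDl.
rewrite (modn_small un) -addnBA ?modnDml; last lia.
rewrite -addnA (_ : d + (n - u) = d + n - u); last lia.
by rewrite subnKC ?modnDr ?modn_small //; lia.
Qed.

Lemma vtx_cdist (p q : 'I_n) : vtx (p + cdist p q) = q.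
Proof.
apply: val_inj; rewrite /= /cdist modnDmr.
have := ltn_ord p; have := ltn_ord q => hq hp.
by rewrite subnKC ?modnDr ?modn_small //; lia.
Qed.

Lemma ltn_cdist (p q : 'I_n) : cdist p q < n.
Proof. by rewrite ltn_mod (n_gt0 n_gt2). Qed.

Lemma cdist_gt0 (p q : 'I_n) : p != q -> 0 < cdist p q.
Proof.
move=> pq; rewrite lt0n; apply: contraNneq pq => h.
by rewrite -(vtx_cdist p q) h addn0 vtx_ord.
Qed.

Hypothesis tri : triangulation sig.

Lemma is_side_seg p q : p < q < p + n ->
  is_side (seg p q) = (q == p.+1) || (q == p + n.-1).
Proof.
move=> h; rewrite /is_side.
have := seg1E n_gt2 p q; have := seg2E n_gt2 p q.
rewrite (divn_eq p n) addnC in h *.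
have un : p %% n < n by rewrite ltn_mod (n_gt0 n_gt2).
move: (p %% n) (p %/ n) un h => u k un h.
have -> : q = u + k * n + (q - (u + k * n)) by lia.
have : 0 < q - (u + k * n) < n by lia.
move: (q - _) => d dn.
rewrite (addnAC u _ d) !vtxDMn.
have vu : vtx u = u :> nat by rewrite val_vtx ?un //; lia.
have vd := @val_vtx n n_gt2 (u + d); move: (vtx u) (vtx (u + d)) vu vd => x y /= vu vd.
by move=> -> ->; case: ifP; case: ifP vd; lia.
Qed.

Lemma has_diagP q : has_diag sig (vtx q) <->
  exists y, [/\ q.+1 < y, y < q + n.-1 & edg q y].
Proof.
have [hd _ _] := tri; split.
  case/existsP => y; set d := cdist (vtx q) y => hs.
  have hv : vtx (q + d) = y.
    by rewrite -[RHS](vtx_cdist (vtx q)) -/d; apply: val_inj; rewrite /= modnDml.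
  have dn : d < n by apply: ltn_cdist.
  have := hd _ hs; rewrite -hv /is_diag -/(seg _ _) => /andP[lt].
  have d0 : 0 < d.
    apply: cdist_gt0; apply: contraTneq lt => e.
    by rewrite seg1E seg2E hv e ltnn.
  rewrite is_side_seg; last lia.
  move=> ns; exists (q + d); split; try lia.
  by rewrite /edg /seg hv /is_edge hs orbT.
case=> y [h1 h2]; rewrite /edg /is_edge is_side_seg; last lia.
case/orP; first lia.
by move=> hs; apply/existsP; exists (vtx y).
Qed.

(** Without diagonals at q, the labels q + 1 and q + n - 1 are consecutive neighbours of q. This
    third side is what [turn] uses where no external arrow exists. *)
Lemma ear q : ~~ has_diag sig (vtx q) -> edg (q + n.-1) q.+1.
Proof.
move=> nd; rewrite edgC; apply: (@edg_fan _ _ _ tri q); try lia.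
- exact: edg_side.
- rewrite edgC -edgDr (_ : q + n = (q + n.-1).+1); last lia.
  exact: edg_side.
- move=> y /andP[h1 h2]; apply: contra nd => e; apply/has_diagP.
  by exists y.
Qed.

Lemma seg_arrow p q r : p < q -> q < r -> r < p + n ->
  edg p q -> edg p r -> edg q r -> arrow sig (seg p q) (seg p r).
Proof.
move=> pq qr rp e1 e2 e3; apply/orP; left.
apply/existsP; exists (vtx p); apply/existsP; exists (vtx q); apply/existsP; exists (vtx r).
rewrite !eqxx /= /tri3 !cdist_vtx; try lia.
by apply/andP; split; [apply/and5P; split=> //; rewrite ?(edg_neq tri) ?e1 ?e2 //; apply/andP | lia].
Qed.

Lemma turn_arrow q : has_diag sig (vtx q) -> arrow sig (seg (q + n.-1) q) (seg q q.+1).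
Proof.
move=> hd; apply/orP; right; apply/existsP; exists (vtx q); rewrite hd /=.
apply/existsP; exists (vtx (q + n.-1)); apply/existsP; exists (vtx q.+1).
rewrite !eqxx !andbT /=; apply/andP; split.
  rewrite (_ : (q %% n + n).-1 = q %% n + n.-1); last lia.
  by rewrite modnDml.
by rewrite -addn1 -[(q %% n).+1]addn1 modnDml.
Qed.

Variant arrow_spec (x y : edge n) : Prop :=
| InternalArrow p q r of p < n & p < q & q < r & r < p + n & edg p q & edg p r & edg q r
    & x = seg p q & y = seg p r
| ExternalArrow q of q < n & has_diag sig (vtx q) & x = seg (q + n.-1) q & y = seg q q.+1.

Lemma arrowP x y : arrow sig x y -> arrow_spec x y.
Proof.
case/orP.
  case/existsP => p /existsP[q /existsP[r /and4P[/eqP-> /eqP->]]].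
  move=> /and5P[n1 n2 n3 e1 /andP[e2 e3]] lt.
  have hp : vtx p = p by rewrite vtx_ord.
  have := vtx_cdist p q; have := vtx_cdist p r => hr hq.
  have := cdist_gt0 n1; have := ltn_cdist p r => c1 c2.
  apply: (@InternalArrow _ _ p (p + cdist p q) (p + cdist p r)).
  all: rewrite ?/edg ?/seg ?hp ?hq ?hr //; try lia.
case/existsP => q /andP[hd] /existsP[p /existsP[r /and4P[/eqP h1 /eqP h2 /eqP-> /eqP->]]].
have hq : vtx q = q by rewrite vtx_ord.
apply: (@ExternalArrow _ _ q); rewrite ?hq // /seg hq; congr mkE.
  by apply: val_inj; rewrite /= h1; congr (_ %% _); have := ltn_ord q; lia.
by apply: val_inj; rewrite /= h2.
Qed.

Lemma walk_fan q a b : q < a -> a <= b -> b < q + n -> edg q a -> edg q b ->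
  walk sig (seg q a) (fan q a b) /\ wend (seg q a) (fan q a b) = seg q b.
Proof.
move: {-1}(b - a) (leqnn (b - a)) => m; elim: m a => [|m IH] a le qa ab bq ea eb.
  have -> : b = a by lia.
  by rewrite fan_nil.
have [->|ab'] : a = b \/ a < b by lia.
  by rewrite fan_nil.
have [z [az zb ez h ->]] := fan_cons ab' eb.
have [h1 h2] := IH z ltac:(lia) ltac:(lia) zb bq ez eb.
split=> //=; rewrite eqxx h1 andbT /=.
by apply: seg_arrow => //; [lia|apply: (edg_fan tri _ _ _ ea ez) => //; lia].
Qed.

(** Only one end moves. As long as it does not pass the base point, the sorted pair of ends grows
    componentwise; when it does, the sum of the ends drops. Within a window of length n this happens
    at most once. *)
Lemma wt1_seg q a b : q < a -> a <= b -> b < q + n -> wt1 (seg q a) (seg q b) + a %/ n = b %/ n.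
Proof.
rewrite /wt1 !seg1E !seg2E (divn_eq q n) addnC.
have un : q %% n < n by rewrite ltn_mod (n_gt0 n_gt2).
move: (q %% n) (q %/ n) un => u k un qa ab bq.
have [c Ea] : exists c, a = u + k * n + c by exists (a - (u + k * n)); lia.
have [d Eb] : exists c, b = u + k * n + c by exists (b - (u + k * n)); lia.
move: qa ab bq; rewrite {}Ea {}Eb !(addnAC u (k * n)) !vtxDMn.
have dv x : (x + k * n) %/ n = x %/ n + k by rewrite addnC divnMDl ?(n_gt0 n_gt2) // addnC.
rewrite !dv => ua ab bu.
have vu : vtx u = u :> nat by rewrite val_vtx ?un //; lia.
have hc := @val_vtx n n_gt2 (u + c).
have hd := @val_vtx n n_gt2 (u + d).
have dc x : x < n + n -> x %/ n = ~~ (x < n).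
  move=> xn; case: ltnP => c'; first by rewrite divn_small.
  by rewrite -(subnK c') divnDr // divnn (n_gt0 n_gt2) divn_small //; lia.
rewrite !dc; try lia.
move: (vtx u) (vtx (u + c)) (vtx (u + d)) vu hc hd => x y z /= -> hc hd.
have {}hc := hc ltac:(lia); have {}hd := hd ltac:(lia).
case: ifP hc; case: ifP hd => hd1 hd2 hc1 hc2; do 2!case: ifP; lia.
Qed.

Lemma wt_fan q a b : q < a -> a <= b -> b < q + n -> edg q b ->
  wt (fan q a b) + a %/ n = b %/ n.
Proof.
move: {-1}(b - a) (leqnn (b - a)) => m; elim: m a => [|m IH] a le qa ab bq eb.
  have -> : b = a by lia.
  by rewrite fan_nil wt_nil.
have [->|ab'] : a = b \/ a < b by lia.
  by rewrite fan_nil wt_nil.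
have [z [az zb ez h ->]] := fan_cons ab' eb.
have hz := IH z ltac:(lia) ltac:(lia) zb bq eb.
have h1 := @wt1_seg q a z qa (ltnW az) ltac:(lia).
rewrite wt_cons; lia.
Qed.
End Fans.

(** * The congruence defined by the Jacobian relations *)

Section Congruence.
Variables (n : nat) (sig : {set edge n}) (n_gt2 : 2 < n).
Notation vtx := (vtx n_gt2).
Notation seg := (seg n_gt2).
Notation edg := (edg sig n_gt2).
Notation fan := (fan sig n_gt2).
Notation turn := (turn sig n_gt2).
Notation sides := (sides sig n_gt2).
Notation arr := (edge n * edge n)%type.
Hypothesis tri : triangulation sig.

Lemma divnDn x : (x + n) %/ n = (x %/ n).+1.
Proof. by rewrite divnDr // divnn (n_gt0 n_gt2) addn1. Qed.

Lemma edg_prev q : edg q (q + n.-1).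
Proof.
rewrite edgC -edgDr (_ : q + n = (q + n.-1).+1); last lia.
exact: edg_side.
Qed.

Lemma segSn q : seg (q.+1 + n.-1) q.+1 = seg q q.+1.
Proof. by rewrite (_ : q.+1 + n.-1 = q + n) ?segDl //; lia. Qed.

Lemma walk_turn q :
  walk sig (seg (q + n.-1) q) (turn q) /\ wend (seg (q + n.-1) q) (turn q) = seg q q.+1.
Proof.
rewrite /turn; case: ifP => hd /=; split=> //; rewrite !eqxx /=.
  by rewrite turn_arrow.
have e : edg (q + n.-1) q.+1 by apply: ear; rewrite ?hd.
have e' : edg (q + n.-1) (q + n) by rewrite edgDr edgC; apply: edg_prev.
have e1 : edg (q + n.-1) (q.+1 + n) by rewrite edgDr.
have e2 : edg (q + n) (q.+1 + n) by rewrite edgDl edgDr; apply: edg_side.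
have := @seg_arrow _ _ _ tri (q + n.-1) (q + n) (q.+1 + n) ltac:(lia) ltac:(lia) ltac:(lia) e' e1 e2.
rewrite !segDr => ->.
have e3 : edg q.+1 (q + n.-1) by rewrite edgC.
have e4 : edg q.+1 (q + n) by rewrite edgDr edgC; apply: edg_side.
have := @seg_arrow _ _ _ tri q.+1 (q + n.-1) (q + n) ltac:(lia) ltac:(lia) ltac:(lia) e3 e4 ltac:(exact: e').
by rewrite segDr (segC _ q.+1 q) (segC _ q.+1 (q + n.-1)) => ->.
Qed.

Lemma turn_neq0 q : turn q != [::].
Proof. by rewrite /turn; case: ifP. Qed.

(** The moving end jumps over the fixed vertex q + 1, from q to q + 2, which [wt1_seg] does not
    cover. *)
Lemma wt1_turn q : wt1 (seg q q.+1) (seg q.+1 q.+2) + q %/ n = q.+2 %/ n.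
Proof.
rewrite /wt1 !seg1E !seg2E (divn_eq q n) [_ * n + _]addnC.
have un : q %% n < n by rewrite ltn_mod (n_gt0 n_gt2).
move: (q %% n) (q %/ n) un => u k un.
rewrite -!addSn !vtxDMn.
have dv x : (x + k * n) %/ n = x %/ n + k by rewrite addnC divnMDl ?(n_gt0 n_gt2) // addnC.
rewrite !dv.
have vu : vtx u = u :> nat by rewrite val_vtx ?un //; lia.
have hc := @val_vtx n n_gt2 u.+1.
have hd := @val_vtx n n_gt2 u.+2.
have dc x : x < n + n -> x %/ n = ~~ (x < n).
  move=> xn; case: ltnP => c'; first by rewrite divn_small.
  by rewrite -(subnK c') divnDr // divnn (n_gt0 n_gt2) divn_small //; lia.
rewrite !dc; try lia.
move: (vtx u) (vtx u.+1) (vtx u.+2) vu hc hd => x y z /= vu hc hd.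
have {}hc := hc ltac:(lia); have {}hd := hd ltac:(lia).
case: ifP hc; case: ifP hd => hd1 hd2 hc1 hc2; do 2!case: ifP; lia.
Qed.

Lemma wt_turn q : wt (turn q.+1) + q %/ n = q.+2 %/ n.
Proof.
rewrite /turn segSn; case: ifP => hd.
  by rewrite wt_cons wt_nil addn0 wt1_turn.
rewrite (_ : q.+1 + n.-1 = q + n); last lia.
rewrite !wt_cons wt_nil addn0 !segDl.
have := @wt1_seg _ n_gt2 q q.+1 q.+2 ltac:(lia) ltac:(lia) ltac:(lia).
have := @wt1_seg _ n_gt2 q.+2 (q + n) (q.+1 + n) ltac:(lia) ltac:(lia) ltac:(lia).
rewrite !segDr !divnDn (segC n_gt2 q.+2 q) (segC n_gt2 q.+2 q.+1).
by lia.
Qed.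

Lemma walk_sides a b : a <= b ->
  walk sig (seg a a.+1) (sides a.+1 b.+1) /\ wend (seg a a.+1) (sides a.+1 b.+1) = seg b b.+1.
Proof.
elim: b => [|b IH] ab.
  by have -> : a = 0 by [lia]; rewrite sides_nil.
have [->|ab'] : a = b.+1 \/ a <= b by lia.
  by rewrite sides_nil.
have [h1 h2] := IH ab'.
rewrite sidesS // walk_cat wend_cat h1 h2 -segSn /=.
by have [-> ->] := walk_turn b.+1.
Qed.

(** The sum of the two quotients acts as a potential on lifted edges, and every turn raises it by
    its weight. *)
Lemma wt_sides a b : a <= b ->
  wt (sides a.+1 b.+1) + (a %/ n + a.+1 %/ n) = b %/ n + b.+1 %/ n.
Proof.
elim: b => [|b IH] ab.
  by have -> : a = 0 by [lia]; rewrite sides_nil wt_nil.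
have [->|ab'] : a = b.+1 \/ a <= b by lia.
  by rewrite sides_nil wt_nil.
rewrite sidesS // wt_cat; have := IH ab'; have := wt_turn b; lia.
Qed.

(* The defining relation says that d/da W = 0 for the arrow a from [q,r] to [q,p]; when q meets no
   diagonal both sides coincide, so that no condition on q is needed. *)
Inductive weq : seq arr -> seq arr -> Prop :=
| weq_tri p q r of p < q & q < r & r < p + n & edg p q & edg p r & edg q r :
    weq [:: (seg p q, seg p r); (seg p r, seg q r)]
        (fan q (p + n) (q + n.-1) ++ turn q ++ fan q q.+1 r)
| weq_refl w : weq w w
| weq_sym v w of weq v w : weq w v
| weq_trans u v w of weq u v & weq v w : weq u w
| weq_cat u u' v v' of weq u u' & weq v v' : weq (u ++ v) (u' ++ v').

Lemma weq_catl u v v' : weq v v' -> weq (u ++ v) (u ++ v').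
Proof. by move=> h; apply: weq_cat => //; apply: weq_refl. Qed.
Lemma weq_catr u u' v : weq u u' -> weq (u ++ v) (u' ++ v).
Proof. by move=> h; apply: weq_cat => //; apply: weq_refl. Qed.

(** By additivity only the generator matters, and there both weights telescope to
    [r %/ n - p %/ n]. *)
Lemma weq_wt v w : weq v w -> wt v = wt w.
Proof.
elim=> {v w} [p q r pq qr rp e1 e2 e3| | |u v w _ -> _ ->|u u' v v' _ h _ h'] //; last first.
  by rewrite !wt_cat h h'.
rewrite !wt_cat !wt_cons wt_nil.
have := @wt1_seg _ n_gt2 p q r pq (ltnW qr) rp.
have := @wt1_seg _ n_gt2 r (p + n) (q + n) rp ltac:(lia) ltac:(lia).
have := @wt_fan _ sig n_gt2 q (p + n) (q + n.-1) ltac:(lia) ltac:(lia) ltac:(lia) (edg_prev q).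
have := @wt_fan _ sig n_gt2 q q.+1 r ltac:(lia) ltac:(lia) ltac:(lia) e3.
have := wt_turn q.-1.
rewrite prednK; last lia.
rewrite (_ : q + n.-1 = q.-1 + n) ?divnDn; last lia.
rewrite !segDr (segC n_gt2 r p) (segC n_gt2 r q).
lia.
Qed.

Lemma walk_start x y (w : seq arr) : w != [::] -> walk sig x w -> walk sig y w -> x = y.
Proof. by case: w => //= a w _ /andP[/eqP <- _] /andP[/eqP <- _]. Qed.

Lemma weq_tri_walk p q r : p < q -> q < r -> r < p + n -> edg p q -> edg p r -> edg q r ->
  let w := fan q (p + n) (q + n.-1) ++ turn q ++ fan q q.+1 r in
  walk sig (seg p q) w /\ wend (seg p q) w = seg q r.
Proof.
move=> pq qr rp e1 e2 e3 /=; rewrite !walk_cat !wend_cat.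
have [||||| h1 h2] := @walk_fan _ _ n_gt2 tri q (p + n) (q + n.-1); try lia.
- by rewrite edgDr edgC.
- exact: edg_prev.
rewrite segDr segC in h1 h2; rewrite h1 h2 segC.
have [-> ->] := walk_turn q.
by have [||||| ->] := @walk_fan _ _ n_gt2 tri q q.+1 r; try lia; try exact: edg_side.
Qed.

Lemma seg_arrow2 p q r : p < q -> q < r -> r < p + n -> edg p q -> edg p r -> edg q r ->
  arrow sig (seg p r) (seg q r).
Proof.
move=> pq qr rp e1 e2 e3.
have e2' : edg r (p + n) by rewrite edgDr edgC.
have e3' : edg r (q + n) by rewrite edgDr edgC.
have e1' : edg (p + n) (q + n) by rewrite edgDr edgDl.
have := @seg_arrow _ _ _ tri r (p + n) (q + n) rp ltac:(lia) ltac:(lia) e2' e3' e1'.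
by rewrite !segDr (segC _ r p) (segC _ r q).
Qed.

(** [weq] also relates lists that are not walks. Both sides of the generator are nonempty walks from
    [p,q] to [q,r], and a nonempty walk determines its start, so no other start can make either of
    them a walk. *)
Lemma weq_walk v w : weq v w -> forall x,
  walk sig x v = walk sig x w /\ (walk sig x v -> wend x v = wend x w).
Proof.
elim=> {v w} [p q r pq qr rp e1 e2 e3|//|v w _ IH|u v w _ IH1 _ IH2|u u' v v' _ IH1 _ IH2] x.
- have [h1 h2] := weq_tri_walk pq qr rp e1 e2 e3.
  have h3 : walk sig (seg p q) [:: (seg p q, seg p r); (seg p r, seg q r)].
    by rewrite /= !eqxx (seg_arrow tri) // seg_arrow2.
  have [->|nx] := eqVneq x (seg p q); first by rewrite h1 h2 h3.
  have -> : walk sig x [:: (seg p q, seg p r); (seg p r, seg q r)] = false.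
    by rewrite /= eq_sym (negbTE nx).
  split=> //; apply/esym/negP => h; move/eqP: nx; apply.
  apply: walk_start h h1; rewrite -size_eq0 !size_cat.
  by have := turn_neq0 q; rewrite -size_eq0; lia.
- by have [h1 h2] := IH x; rewrite h1; split=> // h; rewrite h2 // h1.
- have [h1 h2] := IH1 x; have [h3 h4] := IH2 x; rewrite h1 h3; split=> // h.
  by rewrite h2 ?h4 // ?h1 h3.
- rewrite !walk_cat !wend_cat; have [h1 h2] := IH1 x.
  case hx : (walk sig x u); last by rewrite -h1 hx.
  by rewrite -h1 hx -h2 //; have [h3 h4] := IH2 (wend x u); rewrite h3 /=; split=> // h; rewrite h4 // h3.
Qed.

Lemma fan_tri p q r : p < q -> q < r -> r < p + n -> edg p r -> edg q r ->
  fan p q r = [:: (seg p q, seg p r)].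
Proof.
move=> pq qr rp e1 e2; apply: fan_step => // y /andP[qy yr].
by apply/negP => e; apply: (edg_nocross tri pq qy yr rp e e2).
Qed.

(* Induction on q - p: the apex of the triangle below [p,q] splits the chain of sides in two. *)
Lemma fan_sides p q : p < q -> q < p + n -> edg p q ->
  weq (fan p p.+1 q ++ fan q (p + n) (q + n.-1)) (sides p.+1 q).
Proof.
move: {-1}(q - p) (leqnn (q - p)) => m; elim: m p q => [|m IH] p q le pq qp e; first lia.
have [->|pq'] : q = p.+1 \/ p.+1 < q by lia.
  rewrite (_ : p.+1 + n.-1 = p + n); last lia.
  by rewrite !fan_nil sides_nil; apply: weq_refl.
have [r [pr rq e1 e2]] := edg_apex tri pq' qp e.
have IH1 := IH p r ltac:(lia) pr ltac:(lia) e1.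
have IH2 := IH r q ltac:(lia) rq ltac:(lia) e2.
rewrite -(@fan_cat _ _ _ p p.+1 r q) //; last lia.
rewrite -(@fan_cat _ _ _ q (p + n) (r + n) (q + n.-1)); try lia; last by rewrite edgDr edgC.
rewrite (@fan_tri p r q) // (@fan_tri q (p + n) (r + n)); try lia; first last.
- by rewrite edgDl edgDr.
- by rewrite edgDr edgC.
rewrite !segDr (segC _ q p) (segC _ q r) -catA.
apply: weq_trans (weq_catl _ (weq_catr _ (weq_tri pr rq qp e1 e e2))) _.
rewrite -(@sides_cat _ _ _ p.+1 r q); try lia.
rewrite -(@sides_cat _ _ _ r r.+1 q) // sides1.
by rewrite -!catA catA; apply: weq_cat => //; apply: weq_catl.
Qed.

(** The minimal cycle around P_a based at the edge [a,b]. If P_a meets no diagonal, [turn] makes it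
    the cyclic triangle of the ear at P_a. *)
Definition cyc a b := fan a b (a + n.-1) ++ turn a ++ fan a a.+1 b.

Lemma cycD a b : cyc (a + n) (b + n) = cyc a b.
Proof.
rewrite /cyc turnD !fanDl -addSn (_ : a + n + n.-1 = a + n.-1 + n); last lia.
by rewrite !fanDr.
Qed.

Lemma cycDM a b k : cyc (a + k * n) (b + k * n) = cyc a b.
Proof.
elim: k => [|k IH]; first by rewrite !addn0.
by rewrite mulSn !(addnC n) !addnA cycD.
Qed.

Section Triangle.
Variables (p q r : nat).
Hypotheses (pq : p < q) (qr : q < r) (rp : r < p + n)
  (e1 : edg p q) (e2 : edg p r) (e3 : edg q r).

Lemma tri_cyc1 :
  weq [:: (seg p q, seg p r); (seg p r, seg q r); (seg q r, seg p q)] (cyc q (p + n)).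
Proof.
have := weq_catr [:: (seg q r, seg p q)] (weq_tri pq qr rp e1 e2 e3).
have -> : [:: (seg q r, seg p q)] = fan q r (p + n).
  by rewrite fan_tri ?edgDr 1?edgC // ?segDr ?(segC _ q p) //; lia.
by rewrite -!catA (@fan_cat _ _ _ q q.+1 r) //; lia.
Qed.

Lemma tri_cyc2 :
  weq [:: (seg p q, seg p r); (seg p r, seg q r); (seg q r, seg p q)] (cyc p q).
Proof.
have e1' : edg r (p + n) by rewrite edgDr edgC.
have e2' : edg r (q + n) by rewrite edgDr edgC.
have e3' : edg (p + n) (q + n) by rewrite edgDl edgDr.
(* The generator for the same triangle read from r: it rewrites the two arrows leaving [p,r], so
   that with the first arrow [p,q] -> [p,r] a full turn around p appears. *)
have := weq_tri rp (_ : p + n < q + n) (_ : q + n < r + n) e1' e2' e3'.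
rewrite (_ : p + n + n.-1 = p + n.-1 + n); last lia.
rewrite -addSn !fanDl !fanDr !segDl !segDr turnD (segC _ r p) (segC _ r q).
move=> /(_ ltac:(lia) ltac:(lia)) /(weq_catl [:: (seg p q, seg p r)]) h.
apply: weq_trans h _.
rewrite -(@fan_tri p q r) // catA (@fan_cat _ _ _ p q r) //; try lia.
exact: weq_refl.
Qed.
End Triangle.

(** Both cycles equal the cyclic triangle lying on one side of the edge. [key] uses the triangle
    whose apex is beyond b; for q = p + n - 1 nothing lies there, and the roles of the two ends are
    exchanged. *)
Lemma cyc_swap p q : p < q -> q < p + n -> edg p q -> weq (cyc p q) (cyc q (p + n)).
Proof.
have key a b : a < b -> b < a + n.-1 -> edg a b -> weq (cyc a b) (cyc b (a + n)).
  move=> ab ba e.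
  have [|||r [h1 h2 h3 h4]] := @edg_apex _ sig n_gt2 tri b (a + n); try lia.
    by rewrite edgDr edgC.
  rewrite edgDr edgC in h4.
  by apply: weq_trans (weq_sym (tri_cyc2 ab h1 h2 e h4 h3)) (tri_cyc1 ab h1 h2 e h4 h3).
move=> pq qp e.
have [c|c] : q < p + n.-1 \/ q = p + n.-1 by lia.
  exact: key.
apply: weq_sym; rewrite -(cycD p q); apply: key; try lia.
by rewrite edgDr edgC.
Qed.

(** A representative of C at e; by [cyc_swap] it is irrelevant which end of e is circled. *)
Definition ecyc (e : edge n) := cyc e.1 e.2.

Lemma cyc_ecyc a b : a < b -> b < a + n -> edg a b -> weq (cyc a b) (ecyc (seg a b)).
Proof.
rewrite /ecyc (divn_eq a n) addnC.
have un : a %% n < n by rewrite ltn_mod (n_gt0 n_gt2).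
move: (a %% n) (a %/ n) un => u k un ub bu.
have [c Eb] : exists c, b = c + k * n by exists (b - k * n); lia.
move: ub bu; rewrite {}Eb /edg cycDM seg1E seg2E /seg !vtxDMn => ub bu e.
have vu : vtx u = u :> nat by rewrite val_vtx ?un //; lia.
have vc := @val_vtx n n_gt2 c ltac:(lia).
have e0 : edg u c by [].
move: (vtx u) (vtx c) vu vc {e} => x y /= vu vc.
case: ltnP vc => cn vc; case: ifP => xy; rewrite vu vc; try lia; first exact: weq_refl.
rewrite -{1}(subnK cn); apply: weq_sym; apply: cyc_swap; try lia.
by rewrite -edgDl subnK // edgC.
Qed.

(** Source and target share a vertex, and by [cyc_ecyc] both cycles may be taken around it. The
    arrow is then a segment of that turn, and the two sides become the same word. *)
Lemma arrow_central x y : arrow sig x y ->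
  weq (ecyc x ++ [:: (x, y)]) ((x, y) :: ecyc y).
Proof.
case/(arrowP n_gt2) => [p q r pn pq qr rp e1 e2 e3 -> ->|q qn hd -> ->].
  apply: weq_trans (weq_catr _ (weq_sym (cyc_ecyc pq ltac:(lia) e1))) _.
  apply: weq_trans (weq_catl [:: _] (cyc_ecyc (_ : p < r) rp e2)); last lia.
  rewrite -(@fan_tri p q r) // /cyc.
  rewrite -(@fan_cat _ _ _ p q r (p + n.-1)) //; try lia.
  rewrite -(@fan_cat _ _ _ p p.+1 q r) //; last lia.
  rewrite -!catA; exact: weq_refl.
have e1 := edg_prev; have e2 := edg_side sig n_gt2 q.
have h1 := @cyc_ecyc q (q + n.-1) ltac:(lia) ltac:(lia) (e1 q).
have h2 := @cyc_ecyc q q.+1 ltac:(lia) ltac:(lia) e2.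
rewrite (segC _ (q + n.-1)).
apply: weq_trans (weq_catr _ (weq_sym h1)) _.
apply: weq_trans (weq_catl [:: _] h2).
have -> : [:: (seg q (q + n.-1), seg q q.+1)] = turn q by rewrite /turn hd segC.
rewrite /cyc !fan_nil cats0 cat0s -!catA.
exact: weq_refl.
Qed.

Lemma arrow_central_wpow x y k : arrow sig x y ->
  weq (wpow (ecyc x) k ++ [:: (x, y)]) ((x, y) :: wpow (ecyc y) k).
Proof.
move=> a; elim: k => [|k IH] /=; first exact: weq_refl.
rewrite -catA; apply: weq_trans (weq_catl _ IH) _.
rewrite -cat1s catA -(cat1s _ (ecyc y ++ _)) (catA [:: _]).
by apply: weq_catr; apply: arrow_central.
Qed.

(** The weights telescope along one full turn, which passes the base point once. *)
Lemma wt_cyc a b : a < b -> b < a + n -> edg a b -> wt (cyc a b) = 1.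
Proof.
move=> ab ba e; rewrite /cyc -(turnD sig n_gt2 a) !wt_cat.
have := @wt_fan _ sig n_gt2 a b (a + n.-1) ab ltac:(lia) ltac:(lia) (edg_prev a).
have := @wt_fan _ sig n_gt2 a a.+1 b ltac:(lia) ab ba e.
have := wt_turn (a + n.-1).
rewrite (_ : (a + n.-1).+1 = a + n); last lia.
rewrite -addSn divnDn; lia.
Qed.

Lemma walk_cyc a b : a < b -> b < a + n -> edg a b ->
  walk sig (seg a b) (cyc a b) /\ wend (seg a b) (cyc a b) = seg a b.
Proof.
move=> ab ba e; rewrite /cyc !walk_cat !wend_cat.
have [||||| -> ->] := @walk_fan _ _ n_gt2 tri a b (a + n.-1); try lia; rewrite ?edg_prev //.
rewrite (segC _ a (a + n.-1)); have [-> ->] := walk_turn a.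
by have [||||| -> ->] := @walk_fan _ _ n_gt2 tri a a.+1 b; try lia; rewrite ?edg_side.
Qed.

Lemma edge_seg x : is_edge sig x ->
  [/\ x = seg x.1 x.2, x.1 < x.2, x.2 < x.1 + n & edg x.1 x.2].
Proof.
move=> e; have := edge_ltn tri e => lt; have h : x = seg x.1 x.2.
  by rewrite /seg !vtx_ord /mkE lt -surjective_pairing.
by split=> //; [have := ltn_ord x.2; lia|rewrite /edg -h].
Qed.

Lemma wt_ecyc x : is_edge sig x -> wt (ecyc x) = 1.
Proof. by case/edge_seg => _ h1 h2 h3; apply: wt_cyc. Qed.

Lemma walk_ecyc x : is_edge sig x -> walk sig x (ecyc x) /\ wend x (ecyc x) = x.
Proof. by move=> /edge_seg[e h1 h2 h3]; have := walk_cyc h1 h2 h3; rewrite -e. Qed.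

End Congruence.

(** * Normal forms of walks starting at a side *)

Lemma mkE_inj n (p q p' q' : 'I_n) : mkE p q = mkE p' q' ->
  (p = p' /\ q = q') \/ (p = q' /\ q = p').
Proof. by rewrite /mkE; case: ifP; case: ifP => _ _ [-> ->]; auto. Qed.

Section NormalForm.
Variables (n : nat) (sig : {set edge n}) (n_gt2 : 2 < n).
Notation vtx := (vtx n_gt2).
Notation seg := (seg n_gt2).
Notation edg := (edg sig n_gt2).
Notation fan := (fan sig n_gt2).
Notation turn := (turn sig n_gt2).
Notation sides := (sides sig n_gt2).
Notation weq := (@weq n sig n_gt2).
Notation cyc := (cyc sig n_gt2).
Notation ecyc := (ecyc sig n_gt2).
Notation arr := (edge n * edge n)%type.
Hypothesis tri : triangulation sig.

(* Canonical walk from the side [i,i+1] to the edge [s,t], where i <= s < t < i + n. *)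
Definition can i s t := sides i.+1 s.+1 ++ fan s s.+1 t.

Lemma vtx_window i a b : i <= a < i + n -> i <= b < i + n -> vtx a = vtx b -> a = b.
Proof.
move=> ha hb e; case: (leqP a b) => ab.
  by apply: vtx_inj e; lia.
by apply/esym; apply: (@vtx_inj _ n_gt2); [lia|rewrite e].
Qed.

(** Lifts to the window are unique, so the end of a walk determines the labels of its canonical
    walk. *)
Lemma seg_window i s t s' t' : i <= s -> s < t -> t < i + n ->
  i <= s' -> s' < t' -> t' < i + n -> seg s t = seg s' t' -> s = s' /\ t = t'.
Proof.
move=> h1 h2 h3 h4 h5 h6 /mkE_inj[] [/(@vtx_window i) a /(@vtx_window i) b].
  by split; [apply: a|apply: b]; lia.
by have := a ltac:(lia) ltac:(lia); have := b ltac:(lia) ltac:(lia); lia.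
Qed.

Lemma walk_can i s t : i <= s -> s < t -> t < i + n -> edg s t ->
  walk sig (seg i i.+1) (can i s t) /\ wend (seg i i.+1) (can i s t) = seg s t.
Proof.
move=> h1 h2 h3 e; rewrite /can walk_cat wend_cat.
have [-> ->] := walk_sides n_gt2 tri h1.
by have [||||| -> ->] := @walk_fan _ _ n_gt2 tri s s.+1 t; try lia; rewrite ?edg_side.
Qed.

Lemma wt_can i s t : i <= s -> s < t -> t < i + n -> edg s t ->
  wt (can i s t) + (i %/ n + i.+1 %/ n) = s %/ n + t %/ n.
Proof.
move=> h1 h2 h3 e; rewrite /can wt_cat; have := wt_sides sig n_gt2 h1.
have := @wt_fan _ sig n_gt2 s s.+1 t ltac:(lia) ltac:(lia) ltac:(lia) e; lia.
Qed.

Section TriangleSteps.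
Variables (i p q r : nat).
Hypotheses (ip : i <= p) (pq : p < q) (qr : q < r) (ri : r < i + n)
  (e1 : edg p q) (e2 : edg p r) (e3 : edg q r).

Let rp : r < p + n. Proof. by lia. Qed.

Lemma can_step1 : can i p q ++ [:: (seg p q, seg p r)] = can i p r.
Proof. by rewrite /can -catA -(@fan_tri _ _ n_gt2 tri p q r) // fan_cat //; lia. Qed.

(** After the relation is applied, the walk goes around p up to q and then around q back to the side
    [q-1,q]; [fan_sides] straightens this into the boundary walk. *)
Lemma can_step2 : weq (can i p r ++ [:: (seg p r, seg q r)]) (can i q r).
Proof.
rewrite -can_step1 /can -!catA.
apply: weq_trans (weq_catl _ (weq_catl _ (weq_tri pq qr rp e1 e2 e3))) _.
rewrite -(@sides_cat _ _ _ i.+1 p.+1 q.+1); try lia.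
rewrite -(@sides_cat _ _ _ p.+1 q q.+1) // sides1 -!catA.
apply: weq_catl; rewrite catA; apply: weq_catr.
by apply: fan_sides => //; lia.
Qed.

(** The arrow turns around q from r to p + n and so leaves the window. Read backwards, [fan_sides]
    completes the turn to a whole cycle around q based at [p,q]. *)
Lemma can_step3 : weq (can i q r ++ [:: (seg q r, seg p q)]) (can i p q ++ ecyc (seg p q)).
Proof.
have e1' : edg q (p + n) by rewrite edgDr edgC.
have c : weq (cyc q (p + n)) (ecyc (seg p q)).
  by rewrite (segC _ p q) -(segDr n_gt2 q p); apply: cyc_ecyc => //; lia.
apply: weq_trans (weq_catl _ c).
have -> : [:: (seg q r, seg p q)] = fan q r (p + n).
  by rewrite (fan_tri tri) ?segDr ?(segC _ q p) //; try lia; rewrite edgDr edgC.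
rewrite /can /cyc -catA fan_cat //; try lia.
rewrite -(@sides_cat _ _ _ i.+1 p.+1 q.+1); try lia.
rewrite -(@sides_cat _ _ _ p.+1 q q.+1) // sides1 -!catA.
apply: weq_catl; rewrite (catA (fan p _ _)); apply: weq_catr; apply: weq_sym.
by apply: fan_sides => //; lia.
Qed.
End TriangleSteps.

Lemma can_side i : can i i i.+1 = [::].
Proof. by rewrite /can sides_nil fan_nil. Qed.

(** External arrows fall into three cases: q and q + 1 inside the window, q its last label, and q =
    i + n. Only the last two wrap around and cost a cycle. *)
Lemma can_turn1 i q : i < q -> can i q.-1 q ++ turn q = can i q q.+1.
Proof.
move=> iq; rewrite /can prednK; last lia.
by rewrite !fan_nil !cats0 sidesS.
Qed.

Lemma can_turn2 i q : q.+1 = i + n ->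
  weq (can i q.-1 q ++ turn q) (can i i q ++ ecyc (seg q (i + n))).
Proof.
move=> eq; have e : edg q (i + n) by rewrite -eq edg_side.
apply: weq_trans (weq_catl _ (cyc_ecyc tri _ _ e)); try lia.
rewrite /can sides_nil prednK; last lia.
rewrite fan_nil cats0 /= /cyc -eq fan_nil cats0 catA; apply: weq_catr.
apply: weq_sym; have := @fan_sides _ _ n_gt2 tri i q; rewrite eq; apply; try lia.
by rewrite edgDr edgC in e.
Qed.

Lemma can_turn3 i : can i i (i + n.-1) ++ turn i = cyc i i.+1.
Proof. by rewrite /can sides_nil /cyc fan_nil cats0. Qed.

Definition in_window i s t := [/\ i <= s, s < t, t < i + n & edg s t].

Lemma can_step i s t y : i < n -> in_window i s t -> arrow sig (seg s t) y ->
  exists s' t' d, [/\ in_window i s' t', y = seg s' t' &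
    weq (can i s t ++ [:: (seg s t, y)]) (can i s' t' ++ wpow (ecyc y) d)].
Proof.
move=> i_n [h1 h2 h3 e0].
have wi s' t' := @seg_window i s t s' t' h1 h2 h3.
have tstep P Q R (d := (seg P Q, seg P R)) : i <= P -> P < Q -> Q < R -> R < i + n ->
   edg P Q -> edg P R -> edg Q R ->
   (seg s t, y) \in [:: (seg P Q, seg P R); (seg P R, seg Q R); (seg Q R, seg P Q)] ->
   exists s' t' d, [/\ in_window i s' t', y = seg s' t' &
     weq (can i s t ++ [:: (seg s t, y)]) (can i s' t' ++ wpow (ecyc y) d)].
  move=> iP PQ QR Ri e1 e2 e3; rewrite !inE => /or3P[] /eqP[] es ->.
  - have [-> ->] := wi P Q iP PQ ltac:(lia) es.
    exists P, R, 0; split=> //; first by split=> //; lia.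
    by rewrite can_step1 // cats0; apply: weq_refl.
  - have [-> ->] := wi P R iP ltac:(lia) Ri es.
    exists Q, R, 0; split=> //; first by split=> //; lia.
    by rewrite cats0; apply: can_step2.
  - have [-> ->] := wi Q R ltac:(lia) QR Ri es.
    exists P, Q, 1; split=> //; first by split=> //; lia.
    by rewrite /= cats0; apply: can_step3.
(* Here only the centre p is known to lie in the window. If r, or both q and r, pass i + n, reducing
   them by n rotates the triangle, and the same arrow reappears as the third or second arrow of
   [tstep]. *)
have key p q r : i <= p -> p < i + n -> p < q -> q < r -> r < p + n ->
   edg p q -> edg p r -> edg q r -> seg s t = seg p q -> y = seg p r ->
   exists s' t' d, [/\ in_window i s' t', y = seg s' t' &
     weq (can i s t ++ [:: (seg s t, y)]) (can i s' t' ++ wpow (ecyc y) d)].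
  move=> ip pi pq qr rp e1 e2 e3 es ey.
  have [c|c] := ltnP r (i + n).
    by apply: (tstep p q r) => //; rewrite es ey mem_head.
  have [r0 er] : exists r0, r = r0 + n by exists (r - n); lia.
  subst r; rewrite edgDr edgC in e2; rewrite edgDr edgC in e3.
  rewrite segDr segC in ey.
  have [c'|c'] := ltnP q (i + n).
    by apply: (tstep r0 p q) => //; try lia; rewrite es ey !inE eqxx !orbT.
  have [q0 eq] : exists q0, q = q0 + n by exists (q - n); lia.
  subst q; rewrite edgDr edgC in e1; rewrite edgDr edgC in e3.
  rewrite segDr (segC _ p) in es.
  by apply: (tstep q0 r0 p) => //; try lia; rewrite es ey !inE eqxx !orbT.
case/(arrowP n_gt2) => [p q r pn pq qr rp e1 e2 e3 es ey|q qn hd es ey].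
  have [c|c] := leqP i p; first by apply: (key p q r) => //; lia.
  apply: (key (p + n) (q + n) (r + n)); rewrite ?edgDl ?edgDr ?segDl ?segDr //; lia.
(* The centre of an external arrow is lifted to i + 1, ..., i + n, and not to the window itself, so
   that its predecessor [q'.-1] is still at least i. *)
have {qn hd es ey} [q' [iq qi hd es ey]] : exists q',
    [/\ i < q', q' <= i + n, has_diag sig (vtx q'), seg s t = seg q'.-1 q' & y = seg q' q'.+1].
  have [c|c] := ltnP i q.
    exists q; split=> //; first lia.
    by rewrite es (_ : q + n.-1 = q.-1 + n) ?segDl //; lia.
  exists (q + n); split; rewrite ?vtxDn // -?addSn ?segDl ?segDr //; try lia.
  by rewrite (_ : (q + n).-1 = q + n.-1) //; lia.
have turnE : [:: (seg q'.-1 q', y)] = turn q'.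
  by rewrite /turn hd ey (_ : q' + n.-1 = q'.-1 + n) ?segDl //; lia.
have [c|c] : q'.+1 < i + n \/ i + n <= q'.+1 by lia.
  have [-> ->] := wi q'.-1 q' ltac:(lia) ltac:(lia) ltac:(lia) es.
  rewrite turnE; exists q', q'.+1, 0; split=> //; first by split; rewrite ?edg_side //; lia.
  by rewrite can_turn1 // cats0; apply: weq_refl.
have [c'|c'] : q'.+1 = i + n \/ q' = i + n by lia.
  have [-> ->] := wi q'.-1 q' ltac:(lia) ltac:(lia) ltac:(lia) es.
  have ey' : y = seg i q' by rewrite ey c' segDr segC.
  rewrite turnE; exists i, q', 1; split=> //.
    split; try lia; rewrite (_ : q' = i + n.-1) ?edg_prev //; lia.
  by rewrite /= cats0 ey' segC -(segDr n_gt2 q' i); apply: can_turn2.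
have eqs : seg q'.-1 q' = seg i (i + n.-1).
  by rewrite c' segDr segC (_ : (i + n).-1 = i + n.-1) //; lia.
have [-> ->] := wi i (i + n.-1) ltac:(lia) ltac:(lia) ltac:(lia) (etrans es eqs).
rewrite -eqs turnE c' turnD can_turn3.
have ey' : y = seg i i.+1 by rewrite ey c' -addSn segDl segDr.
exists i, i.+1, 1; split=> //; first by split; rewrite ?edg_side //; lia.
by rewrite can_side /= cats0 ey'; apply: cyc_ecyc; rewrite ?edg_side //; lia.
Qed.
(** Induction on the last arrow: the accumulated cycles are moved past it by centrality, and
    [can_step] absorbs it into the canonical walk. *)
Lemma normal_form i w : i < n -> walk sig (seg i i.+1) w -> exists s t k,
  [/\ in_window i s t, wend (seg i i.+1) w = seg s t &
      weq w (can i s t ++ wpow (ecyc (seg s t)) k)].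
Proof.
move=> i_n; elim/last_ind: w => [|w [x y] IH].
  move=> _; exists i, i.+1, 0; rewrite can_side; split=> //; last exact: weq_refl.
  by split; rewrite ?edg_side //; lia.
rewrite -cats1 walk_cat wend_cat => /andP[hw /= /and3P[/eqP hx ar _]].
have [s [t [k [win e eqw]]]] := IH hw.
rewrite e in hx; subst x.
have [s' [t' [d [win' ey eqs]]]] := can_step i_n win ar.
exists s', t', (d + k); split=> //.
apply: weq_trans (weq_catr _ eqw) _; rewrite -catA.
apply: weq_trans (weq_catl _ (arrow_central_wpow n_gt2 tri k ar)) _.
rewrite -cat1s catA; apply: weq_trans (weq_catr _ eqs) _.
rewrite -ey -catA; apply: weq_catl.
by elim: d {eqs} => [|d IHd] /=; [exact: weq_refl|rewrite -catA; apply: weq_catl].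
Qed.

(** The end determines the canonical walk, and the weight determines the number of cycles, each of
    weight 1. *)
Lemma weq_of_wt i v w : i < n -> walk sig (seg i i.+1) v -> walk sig (seg i i.+1) w ->
  wend (seg i i.+1) v = wend (seg i i.+1) w -> wt v = wt w -> weq v w.
Proof.
move=> i_n hv hw ee.
have [s [t [k [[a1 a2 a3 a4] ev qv]]]] := normal_form i_n hv.
have [s' [t' [k' [[b1 b2 b3 b4] ew qw]]]] := normal_form i_n hw.
have [] := seg_window a1 a2 a3 b1 b2 b3; first by rewrite -ev -ew.
move=> ? ?; subst s' t'.
rewrite (weq_wt qv) (weq_wt qw) !wt_cat !wpow_wt (wt_ecyc n_gt2 tri) // !muln1.
move=> /addnI ?; subst k'; exact: weq_trans qv (weq_sym qw).
Qed.

End NormalForm.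

(** * Linear combinations of paths *)

Local Notation pcomp := Defs.pcomp.

Section LinearExtension.
Local Open Scope ring_scope.
Variables (K : fieldType) (n : nat).
Notation path := (seq (edge n)).
Notation KQ := (KQ K n).

(** Terms are collected by class. With [id] this shows that linear extensions respect [eqKQ]; with
    [pclass] it reduces an element to one coefficient per class of paths. *)
Lemma big_class (T : eqType) (V : lmodType K) (cl : path -> T) (G : T -> V) (u : KQ) :
  (forall t, \sum_(c <- u | cl c.2 == t) c.1 = 0) -> \sum_(c <- u) c.1 *: G (cl c.2) = 0.
Proof.
move=> h; pose s := undup [seq cl c.2 | c <- u].
transitivity (\sum_(t <- s) (\sum_(c <- u | cl c.2 == t) c.1) *: G t).
  under [RHS]eq_bigr do rewrite scaler_suml big_mkcond.
  rewrite exchange_big /=; apply: eq_big_seq => c cu.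
  rewrite (bigD1_seq (cl c.2)) /= ?undup_uniq //; last first.
    by rewrite mem_undup map_f.
  rewrite eqxx big1 ?addr0 // => t nt.
  by rewrite eq_sym (negbTE nt).
by apply: big1 => t _; rewrite h scale0r.
Qed.

(** Elements of [KQ] are unreduced lists of terms. Testing against all linear extensions replaces
    coefficientwise comparison and turns sums and products of lists into algebra in V. *)
Definition lin (V : lmodType K) (g : path -> V) (u : KQ) : V := \sum_(c <- u) c.1 *: g c.2.

Section Lin.
Variables (V : lmodType K).
Implicit Types g : path -> V.

Lemma lin_cat g u v : lin g (u ++ v) = lin g u + lin g v.
Proof. by rewrite /lin big_cat. Qed.

Lemma lin_scale g k u : lin g (scaleKQ k u) = k *: lin g u.
Proof.
by rewrite /lin big_map scaler_sumr; apply: eq_bigr => c _; rewrite scalerA.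
Qed.

Lemma lin_sub g u v : lin g (subKQ u v) = lin g u - lin g v.
Proof. by rewrite lin_cat lin_scale scaleN1r. Qed.

Lemma lin1 g k p : lin g [:: (k, p)] = k *: g p.
Proof. by rewrite /lin big_seq1. Qed.

Lemma lin_cons g c u : lin g (c :: u) = c.1 *: g c.2 + lin g u.
Proof. by rewrite /lin big_cons. Qed.

Lemma lin_nil g : lin g [::] = 0.
Proof. by rewrite /lin big_nil. Qed.

Lemma lin_flatten (I : Type) g (F : I -> KQ) (s : seq I) :
  lin g (flatten [seq F i | i <- s]) = \sum_(i <- s) lin g (F i).
Proof. by rewrite /lin big_flatten big_map. Qed.

Lemma lin_mul g u v : lin g (mulKQ u v) =
  lin (fun p => lin (fun q => if pcomp p q then g (p ++ behead q) else 0) v) u.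
Proof.
rewrite /mulKQ lin_flatten; apply: eq_bigr => c _.
rewrite /lin big_map big_filter big_mkcond scaler_sumr; apply: eq_bigr => d _.
by case: ifP => _; rewrite ?scaler0 // scalerA.
Qed.

Lemma eq_lin g g' u : (forall c, c \in u -> g c.2 = g' c.2) -> lin g u = lin g' u.
Proof. by move=> h; apply: eq_big_seq => c /h ->. Qed.

Lemma lin0 g u : (forall c, c \in u -> g c.2 = 0) -> lin g u = 0.
Proof. by move=> h; rewrite /lin big_seq big1 // => c /h ->; rewrite scaler0. Qed.

Lemma linD g g' u : lin (fun p => g p + g' p) u = lin g u + lin g' u.
Proof. by rewrite /lin -big_split; apply: eq_bigr => c _; rewrite scalerDr. Qed.

Lemma eqKQ_lin g u v : eqKQ u v -> lin g u = lin g v.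
Proof.
move=> h; apply/eqP; rewrite -subr_eq0 -lin_sub; apply/eqP.
apply: (@big_class _ V id g) => p; rewrite big_cat /= big_map /=.
have := h p; rewrite /coef => ->.
by rewrite -mulr_sumr mulN1r subrr.
Qed.
End Lin.

Lemma coef_lin u p : coef u p = lin (fun q => (q == p)%:R : K^o) u.
Proof.
rewrite /coef /lin big_mkcond; apply: eq_bigr => c _.
by case: eqP => _; rewrite ?scaler0 // /GRing.scale /= mulr1.
Qed.

Lemma lin_eqKQ u v : (forall g : path -> K^o, lin g u = lin g v) -> eqKQ u v.
Proof. by move=> h p; rewrite !coef_lin h. Qed.

Definition nonnil (u : KQ) := all (fun c => c.2 != [::]) u.

Lemma mulKQ_all (P Q S : pred path) (u v : KQ) :
  (forall p q, P p -> Q q -> pcomp p q -> S (p ++ behead q)) ->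
  all (fun c => P c.2) u -> all (fun c => Q c.2) v -> all (fun c => S c.2) (mulKQ u v).
Proof.
move=> h /allP hu /allP hv; apply/allP => c /flattenP[s /mapP[a au ->]].
case/mapP => b; rewrite mem_filter => /andP[pc bv] -> /=.
by apply: h pc; [apply: hu|apply: hv].
Qed.

Lemma nonnil_mul u v : nonnil u -> nonnil (mulKQ u v).
Proof.
move=> hu; apply: (@mulKQ_all (fun p => p != [::]) predT (fun p => p != [::])) => //.
  by move=> [].
exact/allP.
Qed.

Lemma pcomp_cons (x y : edge n) (s t : path) :
  pcomp (x :: s) (y :: t) = (last x s == y).
Proof. by rewrite /Defs.pcomp /= last_map. Qed.

Lemma lin_mulA (V : lmodType K) (g : path -> V) u v w : nonnil u -> nonnil v -> nonnil w ->
  lin g (mulKQ (mulKQ u v) w) = lin g (mulKQ u (mulKQ v w)).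
Proof.
move=> /allP hu /allP hv /allP hw; rewrite !lin_mul.
apply: eq_lin => c cu; rewrite lin_mul; apply: eq_lin => d dv.
have := hu _ cu; have := hv _ dv; case: c.2 d.2 => [|x s] // [|y t] // _ _.
rewrite pcomp_cons; case: eqP => [xy|xy].
  apply: eq_lin => e ew; have := hw _ ew; case: e.2 => // z r _.
  by rewrite !pcomp_cons /= last_cat xy eqxx catA.
symmetry; apply: lin0 => e ew.
have := hw _ ew; case: e.2 => // z r _ /=.
by rewrite !pcomp_cons; move/eqP/negbTE: xy => ->; rewrite if_same.
Qed.

Lemma lin_mulDl (V : lmodType K) (g : path -> V) (I : Type) (F : I -> KQ) (s : seq I) w :
  lin g (mulKQ (flatten [seq F i | i <- s]) w) = \sum_(i <- s) lin g (mulKQ (F i) w).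
Proof. by rewrite lin_mul lin_flatten; apply: eq_bigr => i _; rewrite lin_mul. Qed.

Lemma lin_mulDr (V : lmodType K) (g : path -> V) (I : Type) (F : I -> KQ) (s : seq I) w :
  lin g (mulKQ w (flatten [seq F i | i <- s])) = \sum_(i <- s) lin g (mulKQ w (F i)).
Proof.
rewrite lin_mul; elim: s => [|i s IH].
  by rewrite big_nil; apply: lin0 => c _; rewrite lin_nil.
rewrite big_cons -IH lin_mul -linD; apply: eq_lin => c _.
by rewrite /= lin_cat.
Qed.

End LinearExtension.

(** * The ideal J of the path algebra *)

Section JacobianIdeal.
Local Open Scope ring_scope.
Variables (K : fieldType) (n : nat) (sig : {set edge n}).
Notation path := (seq (edge n)).
Notation KQ := (KQ K n).
Notation inJ := (@inJ K n sig).
Notation wfKQ := (@wfKQ K n sig).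
Notation eqJ := (@eqJ K n sig).

Lemma wf_nonnil (u : KQ) : wfKQ u -> nonnil u.
Proof. by apply: sub_all => -[k []]. Qed.

Lemma wf_mul (u v : KQ) : wfKQ u -> wfKQ v -> wfKQ (mulKQ u v).
Proof.
apply: (@mulKQ_all _ _ (valid_path sig) (valid_path sig) (valid_path sig)) => -[|x s] // [|y t] //= /andP[ex px] /andP[ey py].
rewrite pcomp_cons => /eqP e; rewrite ex cat_path px /=; by rewrite e.
Qed.

Lemma wf_scale k (u : KQ) : wfKQ u -> wfKQ (scaleKQ k u).
Proof. by rewrite /Defs.wfKQ all_map. Qed.

Lemma wf_cat (u v : KQ) : wfKQ (u ++ v) = wfKQ u && wfKQ v.
Proof. exact: all_cat. Qed.

Lemma nonnil_dW a : nonnil (dW K sig a).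
Proof.
apply/allP => c /flattenP[s /mapP[d _ ->]] /mapP[e /mapP[i]].
rewrite mem_filter mem_iota /= => /andP[_ hi] -> -> /=.
by rewrite -size_eq0 size_rot -lt0n; apply: leq_ltn_trans hi.
Qed.

Definition Jterm (t : KQ * (edge n * edge n) * KQ) := mulKQ (mulKQ t.1.1 (dW K sig t.1.2)) t.2.

Lemma inJP u : inJ u <-> exists l : seq (KQ * (edge n * edge n) * KQ),
    all (fun t => [&& wfKQ t.1.1, rel_arrow sig t.1.2 & wfKQ t.2]) l /\
    forall (V : lmodType K) (g : path -> V), lin g u = \sum_(t <- l) lin g (Jterm t).
Proof.
split=> -[l [h1 h2]]; exists l; split=> //.
  by move=> V g; rewrite (eqKQ_lin g h2) lin_flatten.
by apply: lin_eqKQ => g; rewrite h2 lin_flatten.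
Qed.

Lemma inJ_lin u v : (forall (V : lmodType K) (g : path -> V), lin g u = lin g v) -> inJ v -> inJ u.
Proof.
by move=> h /inJP[l [h1 h2]]; apply/inJP; exists l; split=> // V g; rewrite h.
Qed.

Lemma inJ0 : inJ [::].
Proof. by apply/inJP; exists [::]; split=> // V g; rewrite lin_nil big_nil. Qed.

Lemma inJ_cat u v : inJ u -> inJ v -> inJ (u ++ v).
Proof.
move=> /inJP[l [h1 h2]] /inJP[l' [h1' h2']]; apply/inJP; exists (l ++ l').
by rewrite all_cat h1 h1'; split=> // V g; rewrite lin_cat big_cat h2 h2'.
Qed.

Lemma inJ_scale k u : inJ u -> inJ (scaleKQ k u).
Proof.
move=> /inJP[l [h1 h2]]; apply/inJP.
exists [seq ((scaleKQ k t.1.1, t.1.2), t.2) | t <- l]; split.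
  by rewrite all_map; apply: sub_all h1 => t /= /and3P[a b c]; rewrite wf_scale // b c.
move=> V g; rewrite lin_scale h2 big_map scaler_sumr; apply: eq_bigr => t _.
by rewrite !lin_mul lin_scale.
Qed.

Lemma inJ_flatten (I : eqType) (F : I -> KQ) s :
  (forall i, i \in s -> inJ (F i)) -> inJ (flatten [seq F i | i <- s]).
Proof.
elim: s => [|i s IH] h /=; first exact: inJ0.
apply: inJ_cat; first by apply: h; rewrite mem_head.
by apply: IH => j js; apply: h; rewrite inE js orbT.
Qed.

Lemma inJ_mull w u : wfKQ w -> nonnil u -> inJ u -> inJ (mulKQ w u).
Proof.
move=> hw pu /inJP[l [h1 h2]]; apply/inJP.
exists [seq ((mulKQ w t.1.1, t.1.2), t.2) | t <- l]; split.
  by rewrite all_map; apply: sub_all h1 => t /= /and3P[a b c]; rewrite wf_mul // b c.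
move=> V g; rewrite big_map; transitivity (\sum_(t <- l) lin g (mulKQ w (Jterm t))).
  rewrite -lin_mulDr !lin_mul; apply: eq_lin => c _.
  by rewrite h2 lin_flatten.
apply: eq_big_seq => t tl; have /and3P[a b c] := allP h1 _ tl.
rewrite /Jterm /=; have := nonnil_dW t.1.2; have := wf_nonnil hw.
have := wf_nonnil a; have := wf_nonnil c => pc pa pw pd.
rewrite -!lin_mulA ?nonnil_mul // !(lin_mul _ _ t.2).
by rewrite (lin_mulA _ pw pa pd).
Qed.

Lemma inJ_mulr w u : wfKQ w -> nonnil u -> inJ u -> inJ (mulKQ u w).
Proof.
move=> hw pu /inJP[l [h1 h2]]; apply/inJP.
exists [seq (t.1, mulKQ t.2 w) | t <- l]; split.
  by rewrite all_map; apply: sub_all h1 => t /= /and3P[a b c]; rewrite wf_mul // a b.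
move=> V g; rewrite big_map; transitivity (\sum_(t <- l) lin g (mulKQ (Jterm t) w)).
  by rewrite -lin_mulDl lin_mul h2 -lin_flatten lin_mul.
apply: eq_big_seq => t tl; have /and3P[a b c] := allP h1 _ tl.
rewrite /Jterm /=; have := nonnil_dW t.1.2; have := wf_nonnil hw.
have := wf_nonnil a; have := wf_nonnil c => pc pa pw pd.
by rewrite lin_mulA ?nonnil_mul.
Qed.

Lemma eqJ_refl u : eqJ u u.
Proof. by apply: (inJ_lin (v := [::])) inJ0 => V g; rewrite lin_sub subrr lin_nil. Qed.

Lemma eqJ_sym u v : eqJ u v -> eqJ v u.
Proof.
move=> /(inJ_scale (-1)); apply: inJ_lin => V g.
by rewrite lin_scale !lin_sub scaleN1r opprB.
Qed.

Lemma eqJ_trans u v w : eqJ u v -> eqJ v w -> eqJ u w.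
Proof.
move=> h1 h2; have := inJ_cat h1 h2; apply: inJ_lin => V g.
by rewrite lin_cat !lin_sub addrA subrK.
Qed.

(** J is two-sided: the difference is multiplied by [y :: r] on the left and by [last x s :: t] on
    the right. *)
Lemma eqJ_path (x y : edge n) (s s' r t : path) :
  valid_path sig (y :: r) -> last y r = x -> valid_path sig (last x s :: t) -> last x s = last x s' ->
  eqJ [:: (1 : K, x :: s)] [:: (1, x :: s')] ->
  eqJ [:: (1 : K, y :: r ++ s ++ t)] [:: (1, y :: r ++ s' ++ t)].
Proof.
move=> v1 e1 v2 e2 h.
have h1 : inJ (mulKQ [:: (1, y :: r)] (mulKQ (subKQ [:: (1, x :: s)] [:: (1, x :: s')])
  [:: (1, last x s :: t)])).
  apply: inJ_mull; rewrite ?nonnil_mul //; first by rewrite /Defs.wfKQ /= andbT.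
  by apply: inJ_mulr => //; rewrite /Defs.wfKQ /= andbT.
apply: inJ_lin h1 => V g; rewrite !lin_mul !lin_sub !lin1 !lin_mul !lin_sub !lin1.
by rewrite !pcomp_cons /= -e2 !eqxx e1 eqxx !scale1r.
Qed.

End JacobianIdeal.

(** * Weight polynomials of path combinations *)

Section PathPolynomials.
Local Open Scope ring_scope.
Variables (K : fieldType) (n : nat).
Notation path := (seq (edge n)).
Notation KQ := (KQ K n).

Definition pwt (p : path) : nat := if p is x :: s then wt (pairmap pair x s) else 0.

(** Matrix units with powers of x: sending a path to its monomial at (start, end) represents the
    path algebra by matrices over K[x], as [EV_mul] shows. *)
Definition mono (a b : edge n) (p : path) : {poly K} :=
  if (ohead p == Some a) && (last None (map Some p) == Some b) then 'X^(pwt p) else 0.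

Definition EV a b (u : KQ) : {poly K} := lin (mono a b) u.

Lemma mono_cons a b x s :
  mono a b (x :: s) = if (x == a) && (last x s == b) then 'X^(wt (pairmap pair x s)) else 0.
Proof. by rewrite /mono /= last_map. Qed.

Lemma mono_cat a b p q : p != [::] -> q != [::] ->
  (if Defs.pcomp p q then mono a b (p ++ behead q) else 0) = \sum_c mono a c p * mono c b q.
Proof.
case: p q => [|x s] // [|y t] // _ _; rewrite pcomp_cons.
rewrite (bigD1 (last x s)) //= big1 ?addr0; last first.
  by move=> c nc; rewrite mono_cons (eq_sym _ c) (negbTE nc) andbF mul0r.
rewrite !mono_cons eqxx andbT last_cat (eq_sym y) pairmap_cat wt_cat exprD.
by case: eqP => [->|_]; case: eqP => _ /=; rewrite ?mul0r ?mulr0 //; case: eqP => _; rewrite ?mulr0.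
Qed.

Lemma EV_mul a b u v : nonnil u -> nonnil v ->
  EV a b (mulKQ u v) = \sum_c EV a c u * EV c b v.
Proof.
move=> /allP hu /allP hv; rewrite /EV lin_mul.
under [RHS]eq_bigr do rewrite [X in X * _]/lin mulr_suml.
rewrite exchange_big /=; apply: eq_big_seq => p pu.
under [RHS]eq_bigr do rewrite -scalerAl [X in _ *: (_ * X)]/lin mulr_sumr.
rewrite -scaler_sumr exchange_big /=; congr (_ *: _); apply: eq_big_seq => q qv.
under [RHS]eq_bigr do rewrite -scalerAr.
by rewrite -scaler_sumr mono_cat ?(hu _ pu) ?(hv _ qv).
Qed.

Lemma EV_add a b u v : EV a b (addKQ u v) = EV a b u + EV a b v.
Proof. exact: lin_cat. Qed.

Lemma EV_scale a b k u : EV a b (scaleKQ k u) = k *: EV a b u.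
Proof. exact: lin_scale. Qed.

Lemma EV_sub a b u v : EV a b (subKQ u v) = EV a b u - EV a b v.
Proof. exact: lin_sub. Qed.

Lemma EV_path a b k x s : EV a b [:: (k, x :: s)] =
  if (x == a) && (last x s == b) then k *: 'X^(wt (pairmap pair x s)) else 0.
Proof. by rewrite /EV lin1 mono_cons; case: ifP => _; rewrite ?scaler0. Qed.

Variable (sig : {set edge n}).

Lemma EV_inJ a b u : (forall r c d, rel_arrow sig r -> EV c d (dW K sig r) = 0) ->
  inJ sig u -> EV a b u = 0.
Proof.
move=> h0 /inJP[l [/allP h1 h2]]; rewrite /EV h2 big_seq big1 // => t tl.
have /and3P[/wf_nonnil pa ra /wf_nonnil pc] := h1 _ tl.
have pd := nonnil_dW K sig t.1.2.
rewrite -/(EV a b _) /Jterm EV_mul ?nonnil_mul //; apply: big1 => c _.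
by rewrite EV_mul // big1 ?mul0r // => d _; rewrite h0 // mulr0.
Qed.

End PathPolynomials.

(** * Cyclic derivatives of the potential *)

Section Derivatives.
Variables (K : fieldType) (n : nat).
Implicit Types (a : edge n * edge n) (cv : seq (edge n)).
Notation dcyc := (@dcyc K n).

Lemma dcyc_notin a cv : a \notin cyc_arrows cv -> dcyc a cv = [::].
Proof.
move=> h; rewrite /Defs.dcyc (@eq_in_filter _ _ pred0) ?filter_pred0 // => i.
rewrite mem_iota /= add0n => hi; apply/negP => /eqP e; case/negP: h.
by rewrite -e mem_nth // size_zip size_rot minnn.
Qed.

Lemma mem_cyc_arrows a cv : a \in cyc_arrows cv -> a.1 \in cv /\ a.2 \in cv.
Proof.
move=> h; split.
  by have := map_f fst h; rewrite -/(unzip1 _) unzip1_zip // size_rot.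
by have := map_f snd h; rewrite -/(unzip2 _) unzip2_zip ?mem_rot // size_rot.
Qed.

(** Without repeated vertices an arrow occurs at one index only, so the derivative is a single path,
    the cycle cut open at that arrow. *)
Lemma dcyc_split x s1 y s2 : uniq (x :: s1 ++ y :: s2) ->
  dcyc (last x s1, y) (x :: s1 ++ y :: s2) = [:: (1, (y :: s2) ++ x :: s1)]%R.
Proof.
set cv := _ :: _ => u; rewrite /Defs.dcyc.
have sc : size cv = (size s1 + size s2).+2 by rewrite /= size_cat /= addnS.
have szip : size (cyc_arrows cv) = size cv by rewrite size_zip size_rot minnn.
have h : nth (last x s1, y) (cyc_arrows cv) (size s1) = (last x s1, y).
  rewrite /cyc_arrows nth_zip ?size_rot //; congr pair.
    by rewrite /cv -cat_cons nth_cat /= ltnSn -last_nth.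
  rewrite /cv rot1_cons nth_rcons size_cat /= ifT; last by rewrite addnS; lia.
  by rewrite nth_cat ltnn subnn.
have -> : [seq i <- iota 0 (size cv) | nth (last x s1, y) (cyc_arrows cv) i == (last x s1, y)]
    = [:: size s1]; last first.
  by rewrite /= /cv -cat_cons -[(size s1).+1]/(size (x :: s1)) rot_size_cat.
rewrite -(@filter_pred1_uniq _ (iota 0 (size cv)) (size s1)) ?iota_uniq //; last first.
  by rewrite mem_iota add0n sc; lia.
apply: eq_in_filter => i; rewrite mem_iota add0n => /andP[_ hi].
apply/eqP/eqP => [e|->]; last exact: h.
have hs : size s1 < size cv by rewrite sc; lia.
apply/eqP; rewrite -(nth_uniq (last x s1) hi hs u).
have := congr1 fst e; rewrite nth_zip ?size_rot //= => ->.
by have := congr1 fst h; rewrite nth_zip ?size_rot //= => ->.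
Qed.

Lemma dcyc3 e1 e2 e3 : uniq [:: e1; e2; e3] ->
  [/\ dcyc (e1, e2) [:: e1; e2; e3] = [:: (1, [:: e2; e3; e1])]%R,
      dcyc (e2, e3) [:: e1; e2; e3] = [:: (1, [:: e3; e1; e2])]%R &
      dcyc (e3, e1) [:: e1; e2; e3] = [:: (1, [:: e1; e2; e3])]%R].
Proof.
rewrite /= !inE negb_or => /and3P[/andP[n12 n13] n23 _].
rewrite /Defs.dcyc /= !xpair_eqE !eqxx (negbTE n12) (negbTE n13) (negbTE n23).
by rewrite ![e2 == e1]eq_sym ![e3 == e1]eq_sym ![e3 == e2]eq_sym (negbTE n12) (negbTE n13) (negbTE n23).
Qed.

Lemma flatten_single (T : eqType) (U : Type) (F : T -> seq U) (s : seq T) x :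
  uniq s -> x \in s -> (forall y, y \in s -> y != x -> F y = [::]) ->
  flatten [seq F y | y <- s] = F x.
Proof.
elim: s => // y s IH /= /andP[ys us]; rewrite inE => /orP[/eqP->|xs] h.
  rewrite (_ : flatten _ = [::]) ?cats0 //.
  have {}h z : z \in s -> F z = [::].
    move=> zs; apply: h; first by rewrite inE zs orbT.
    by apply: contraNneq ys => ezx; rewrite -ezx.
  elim: s h {IH ys us} => // z s IH h /=.
  by rewrite h ?mem_head // IH // => t ts; apply: h; rewrite inE ts orbT.
rewrite h ?mem_head //; last by apply: contraNneq ys => ->.
by apply: IH => // z zs; apply: h; rewrite inE zs orbT.
Qed.
End Derivatives.

Section PotentialDerivatives.
Variables (K : fieldType) (n : nat) (sig : {set edge n}) (n_gt2 : 2 < n).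
Notation vtx := (vtx n_gt2).
Notation seg := (seg n_gt2).
Notation edg := (edg sig n_gt2).
Notation fan := (fan sig n_gt2).
Notation turn := (turn sig n_gt2).
Notation weq := (@weq n sig n_gt2).
Notation arr := (edge n * edge n)%type.
Hypothesis tri : triangulation sig.
Notation dcyc := (@dcyc K n).

Lemma walk_pairmap x (w : seq arr) : walk sig x w -> pairmap pair x (map snd w) = w.
Proof.
elim: w x => //= -[a b] w IH x /= /and3P[/eqP-> _ h].
by rewrite IH.
Qed.

Lemma path_walk x s : path (arrow sig) x s = walk sig x (pairmap pair x s).
Proof. by elim: s x => //= y s IH x; rewrite eqxx IH. Qed.

Lemma map_snd_pairmap x (s : seq (edge n)) : map snd (pairmap pair x s) = s.
Proof. by elim: s x => //= y s IH x; rewrite IH. Qed.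

Lemma vtx_cyclic p q r : p < q -> q < r -> r < p + n ->
  [|| (vtx p < vtx q < vtx r), (vtx q < vtx r < vtx p) | (vtx r < vtx p < vtx q)].
Proof.
rewrite (divn_eq p n) addnC.
have un : p %% n < n by rewrite ltn_mod (n_gt0 n_gt2).
move: (p %% n) (p %/ n) un => u k un uq qr ru.
have [c Eq] : exists c, q = c + k * n by exists (q - k * n); lia.
have [d Er] : exists c, r = c + k * n by exists (r - k * n); lia.
subst q r; rewrite !vtxDMn.
have vu : vtx u = u :> nat by rewrite val_vtx ?un //; lia.
have vc := @val_vtx n n_gt2 c ltac:(lia).
have vd := @val_vtx n n_gt2 d ltac:(lia).
move: (vtx u) (vtx c) (vtx d) vu vc vd => x y z /= -> vc vd.
by case: ifP vc; case: ifP vd; lia.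
Qed.

Lemma tri3_edges (x y z : 'I_n) : x < y -> y < z -> is_edge sig (mkE x y) ->
  is_edge sig (mkE x z) -> is_edge sig (mkE y z) -> tri3 sig x y z.
Proof.
move=> xy yz e1 e2 e3; rewrite /tri3 e1 e2 e3 !andbT -!val_eqE /=; lia.
Qed.

Definition tri_list (t : 'I_n * 'I_n * 'I_n) : seq (edge n) :=
  [:: mkE t.1.1 t.1.2; mkE t.1.1 t.2; mkE t.1.2 t.2].

(** The ends of the two edges joined by an arrow are together the three corners of its triangle, and
    the increasing order then fixes the triple. *)
Lemma tri_list_inj a (t t' : 'I_n * 'I_n * 'I_n) :
  t.1.1 < t.1.2 -> t.1.2 < t.2 -> t'.1.1 < t'.1.2 -> t'.1.2 < t'.2 ->
  a \in cyc_arrows (tri_list t) -> a \in cyc_arrows (tri_list t') -> t = t'.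
Proof.
pose ends (a : arr) := [:: a.1.1; a.1.2; a.2.1; a.2.2].
have E (s : 'I_n * 'I_n * 'I_n) : s.1.1 < s.1.2 -> s.1.2 < s.2 ->
    a \in cyc_arrows (tri_list s) -> ends a =i [:: s.1.1; s.1.2; s.2].
  move: s => [[x y] z] /= xy yz; have xz := ltn_trans xy yz.
  have -> : tri_list (x, y, z) = [:: (x, y); (x, z); (y, z)].
    by rewrite /tri_list /mkE /= xy yz xz.
  rewrite /cyc_arrows /= !in_cons in_nil orbF => h i.
  case/or3P: h => /eqP->; rewrite /ends /= !in_cons in_nil;
    by case: (i == x); case: (i == y); case: (i == z).
move=> h1 h2 h1' h2' /(E _ h1 h2) e /(E _ h1' h2') e'.
have : [:: t.1.1; t.1.2; t.2] = [:: t'.1.1; t'.1.2; t'.2].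
  apply: (@irr_sorted_eq _ (fun x y : 'I_n => x < y)).
  - by move=> x y z; apply: ltn_trans.
  - by move=> x; apply: ltnn.
  - by rewrite /= h1 h2.
  - by rewrite /= h1' h2'.
  - by move=> i; rewrite -e e'.
by case: t t' {h1 h2 h1' h2' e e'} => [[x y] z] [[x' y'] z'] /= [-> -> ->].
Qed.

Section Arrow.
Variables (p q r : nat).
Hypotheses (pq : p < q) (qr : q < r) (rp : r < p + n)
  (e1 : edg p q) (e2 : edg p r) (e3 : edg q r).

Let a := (seg p q, seg p r).

Lemma dcyc_tri : exists2 t : 'I_n * 'I_n * 'I_n,
  (t.1.1 < t.1.2) && (t.1.2 < t.2) && tri3 sig t.1.1 t.1.2 t.2 &
  a \in cyc_arrows (tri_list t) /\ dcyc a (tri_list t) = [:: (1, [:: seg p r; seg q r; seg p q])]%R.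
Proof.
have key (x y z : 'I_n) : x < y -> y < z -> uniq (tri_list (x, y, z)).
  move=> xy yz; have xz := ltn_trans xy yz.
  by rewrite /tri_list /= !inE /mkE /= xy yz xz !xpair_eqE -!val_eqE /=; lia.
(* Corners are listed increasingly, so the arrow is the first, second or third one of its cycle
   according as p, q or r is the smallest corner. *)
case/or3P: (vtx_cyclic pq qr rp) => /andP[h1 h2].
- exists (vtx p, vtx q, vtx r); first by rewrite h1 h2 tri3_edges.
  have [-> _ _] := dcyc3 K (key _ _ _ h1 h2); split=> //.
  by rewrite /cyc_arrows /= !inE eqxx.
- exists (vtx q, vtx r, vtx p).
    by rewrite h1 h2 tri3_edges // mkE_sym.
  have := dcyc3 K (key _ _ _ h1 h2).
  rewrite /tri_list /= (mkE_sym (vtx q) (vtx p)) (mkE_sym (vtx r) (vtx p)).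
  by move=> [_ -> _]; split=> //; rewrite /cyc_arrows /= !inE eqxx orbT.
- exists (vtx r, vtx p, vtx q).
    by rewrite h1 h2 tri3_edges // mkE_sym.
  have := dcyc3 K (key _ _ _ h1 h2).
  rewrite /tri_list /= (mkE_sym (vtx r) (vtx p)) (mkE_sym (vtx r) (vtx q)).
  by move=> [_ _ ->]; split=> //; rewrite /cyc_arrows /= !inE eqxx !orbT.
Qed.

Lemma dW_tri_part : flatten [seq scaleKQ 1 (dcyc a c) | c <- tri_cycles sig]%R =
  [:: (1, [:: seg p r; seg q r; seg p q])]%R.
Proof.
have [t ht [ta dt]] := dcyc_tri.
rewrite /tri_cycles -map_comp.
rewrite (@flatten_single _ _ _ _ t) ?enum_uniq ?mem_enum //=.
  by rewrite -/(tri_list t) dt /scaleKQ /= mulr1.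
move=> t'; rewrite mem_enum => /andP[/andP[h1 h2] _] nt; rewrite -/(tri_list t').
rewrite dcyc_notin //; apply: contraNN nt => at'; apply/eqP/esym.
by move: ht => /andP[/andP[h3 h4] _]; apply: tri_list_inj ta at'.
Qed.
End Arrow.

End PotentialDerivatives.

(** * The congruence of walks inside the Jacobian algebra *)

Section JacobianRelations.
Variables (K : fieldType) (n : nat) (sig : {set edge n}) (n_gt2 : 2 < n).
Notation vtx := (vtx n_gt2).
Notation seg := (seg n_gt2).
Notation edg := (edg sig n_gt2).
Notation fan := (fan sig n_gt2).
Notation turn := (turn sig n_gt2).
Notation weq := (@weq n sig n_gt2).
Notation arr := (edge n * edge n)%type.
Hypothesis tri : triangulation sig.
Notation dcyc := (@dcyc K n).
Notation eqJ := (@eqJ K n sig).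

Lemma mkE_injr (p : 'I_n) : injective (mkE p).
Proof. by move=> q q' /mkE_inj[[]//|[-> ->]]. Qed.

Lemma big_cycle_uniq p : uniq (big_cycle sig p).
Proof. by rewrite map_inj_uniq ?sort_uniq ?enum_uniq //; apply: mkE_injr. Qed.

(** Both lists run through the neighbours of P_p by increasing [cdist], which separates vertices;
    sorted lists with the same members agree. *)
Lemma big_cycle_vtx p :
  big_cycle sig (vtx p) = seg p p.+1 :: map snd (fan p p.+1 (p + n.-1)).
Proof.
rewrite map_snd_pairmap; set s := [seq seg p c | c <- iota p.+2 _ & _].
have -> : seg p p.+1 :: s = [seq mkE (vtx p) q | q <- [seq vtx c | c <- iota p.+1 n.-1 & edg p c]].
  rewrite -map_comp (_ : n.-1 = (p + n.-1 - p.+1).+1); last lia.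
  by rewrite /= edg_side.
congr map; apply: (@sorted_eq _ (fun q r => cdist (vtx p) q <= cdist (vtx p) r)).
- by move=> x y z; apply: leq_trans.
- move=> x y; rewrite -eqn_leq => /eqP e.
  by rewrite -(vtx_cdist n_gt2 (vtx p) x) e vtx_cdist.
- by apply: sort_sorted => x y; apply: leq_total.
- apply: (@homo_sorted_in _ _ [pred c | p < c < p + n] _ ltn).
  + move=> x y; rewrite !inE => hx hy xy.
    by rewrite !cdist_vtx //; lia.
  + by apply/allP => c; rewrite mem_filter mem_iota inE => /andP[_]; lia.
  + by apply: sorted_filter; [apply: ltn_trans|apply: iota_ltn_sorted].
- apply: uniq_perm; rewrite ?sort_uniq ?enum_uniq //.
    rewrite map_inj_in_uniq ?filter_uniq ?iota_uniq // => x y.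
    rewrite !mem_filter !mem_iota => /andP[_ hx] /andP[_ hy].
    by apply: (@vtx_window _ n_gt2 p); lia.
  move=> q; rewrite mem_sort mem_enum; apply/idP/mapP.
    case/andP => qp eq.
    have hq : vtx (p + cdist (vtx p) q) = q.
      by rewrite -[RHS](vtx_cdist n_gt2 (vtx p) q); apply: val_inj; rewrite /= modnDml.
    exists (p + cdist (vtx p) q) => //.
    rewrite mem_filter /edg /seg hq eq mem_iota.
    have := ltn_cdist n_gt2 (vtx p) q.
    by have := @cdist_gt0 _ n_gt2 (vtx p) q; rewrite eq_sym => /(_ qp); lia.
  case=> c; rewrite mem_filter => /andP[ec _] ->.
  by rewrite inE eq_sym (edg_neq tri ec).
Qed.

Lemma arrow_edges x y : arrow sig x y -> is_edge sig x /\ is_edge sig y.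
Proof.
case/(arrowP n_gt2) => [p q r _ _ _ _ e1 e2 _ -> -> //|q _ _ -> ->]; split.
  by have := edg_prev sig n_gt2 q; rewrite edgC.
exact: edg_side.
Qed.

Lemma wend_edge x (w : seq arr) : is_edge sig x -> walk sig x w -> is_edge sig (wend x w).
Proof.
elim: w x => //= -[a b] w IH x ex /= /and3P[_ ar h].
by apply: IH h; case: (arrow_edges ar).
Qed.

(** If both edges are sides, then q and r are the two polygon neighbours of p, and a diagonal at p
    would cross [q,r]. So the internal arrows giving a relation are those around a vertex with a
    diagonal. *)
Lemma not_sides_has_diag p q r : p < q -> q < r -> r < p + n -> edg p q -> edg p r -> edg q r ->
  ~~ (is_side (seg p q) && is_side (seg p r)) = has_diag sig (vtx p).
Proof.
move=> pq qr rp e1 e2 e3; rewrite !is_side_seg; try lia.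
apply/idP/idP => h.
  have [c|c] : (p.+1 < q) \/ (r < p + n.-1) by lia.
    by apply/has_diagP => //; exists q; split=> //; lia.
  by apply/has_diagP => //; exists r; split=> //; lia.
apply/negP => s; have [eq er] : q = p.+1 /\ r = p + n.-1 by lia.
have [y [h1 h2 ey]] := (has_diagP n_gt2 tri p).1 h.
rewrite -edgDl edgC in ey; rewrite -{}eq in h1.
apply: (@edg_nocross _ _ n_gt2 tri q y r (p + n)) => //; try lia.
Qed.

Section Arrow.
Variables (p q r : nat).
Hypotheses (pq : p < q) (qr : q < r) (rp : r < p + n)
  (e1 : edg p q) (e2 : edg p r) (e3 : edg q r).

Let a := (seg p q, seg p r).

Lemma dW_big_part : has_diag sig (vtx p) ->
  flatten [seq scaleKQ (-1) (dcyc a c) | c <- big_cycles sig]%R =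
  [:: (-1, seg p r :: map snd (fan p r (p + n.-1) ++ turn p ++ fan p p.+1 q))]%R.
Proof.
move=> hd; rewrite /big_cycles -map_comp.
rewrite (@flatten_single _ _ _ _ (vtx p)) ?enum_uniq ?mem_enum //=; last first.
  (* Since q and r are distinct, [p,q] and [p,r] share only the vertex p; no other big cycle
     contains the arrow. *)
  move=> P; rewrite mem_enum => hP nP; rewrite dcyc_notin //.
  apply: contraNN nP => /mem_cyc_arrows /= [/mapP[x _ /mkE_inj h1] /mapP[y _ /mkE_inj h2]].
  have n3 := edg_neq tri e3.
  case: h1 => [[-> _]|[_ h1]] //; case: h2 => [[-> _]|[_ h2]] //.
  by move: n3; rewrite h1 h2 eqxx.
have := big_cycle_uniq (vtx p); rewrite big_cycle_vtx.
have -> : fan p p.+1 (p + n.-1) = fan p p.+1 q ++ a :: fan p r (p + n.-1).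
  rewrite -(@fan_cat _ _ _ p p.+1 q) //; try lia; congr (_ ++ _).
  by rewrite -(@fan_cat _ _ _ p q r) //; try lia; rewrite (fan_tri tri).
rewrite map_cat /= => /dcyc_split.
have [||||| _] := @walk_fan _ _ n_gt2 tri p p.+1 q; try lia; rewrite ?edg_side // /wend => ->.
move=> ->; rewrite /scaleKQ /= mulr1 map_cat /turn hd.
by [].
Qed.

Lemma dW_eq : has_diag sig (vtx p) -> dW K sig a =
  [:: (1, seg p r :: map snd [:: (seg p r, seg q r); (seg q r, seg p q)]);
      (-1, seg p r :: map snd (fan p r (p + n.-1) ++ turn p ++ fan p p.+1 q))]%R.
Proof.
move=> hd.
have -> : dW K sig a = (flatten [seq scaleKQ 1 (dcyc a c) | c <- tri_cycles sig] ++
    flatten [seq scaleKQ (-1) (dcyc a c) | c <- big_cycles sig])%R.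
  by rewrite /dW /pot map_cat flatten_cat -!map_comp.
by rewrite dW_tri_part // dW_big_part.
Qed.

Lemma weq_tri_rot : weq [:: (seg p r, seg q r); (seg q r, seg p q)]
   (fan p r (p + n.-1) ++ turn p ++ fan p p.+1 q).
Proof.
have e1' : edg r (p + n) by rewrite edgDr edgC.
have e2' : edg r (q + n) by rewrite edgDr edgC.
have e3' : edg (p + n) (q + n) by rewrite edgDl edgDr.
have := weq_tri rp (_ : p + n < q + n) (_ : q + n < r + n) e1' e2' e3'.
rewrite (_ : p + n + n.-1 = p + n.-1 + n); last lia.
rewrite -addSn !fanDl !fanDr !segDl !segDr turnD (segC _ r p) (segC _ r q).
by apply; lia.
Qed.

End Arrow.

Lemma EV_weq x v w c d k : weq v w -> walk sig x v ->
  EV c d [:: (k : K, x :: map snd v)] = EV c d [:: (k, x :: map snd w)].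
Proof.
move=> h hv; have [h1 h2] := weq_walk tri h x.
rewrite !EV_path (walk_pairmap hv) (walk_pairmap (_ : walk sig x w)) -?h1 //.
by rewrite -!/(wend _ _) h2 // (weq_wt h).
Qed.

Lemma rel_arrowP a : rel_arrow sig a -> exists p q r, [/\ p < q, q < r, r < p + n,
  a = (seg p q, seg p r) & [/\ edg p q, edg p r, edg q r & has_diag sig (vtx p)]].
Proof.
case: a => x y /andP[/= /(arrowP n_gt2)[p q r _ pq qr rp e1 e2 e3 -> ->|q _ _ -> ->] h].
  by exists p, q, r; split=> //; split=> //; rewrite -(@not_sides_has_diag p q r).
by move: h; rewrite segC !is_side_seg; lia.
Qed.

Lemma tri_walk p q r : p < q -> q < r -> r < p + n -> edg p q -> edg p r -> edg q r ->
  walk sig (seg p q) [:: (seg p q, seg p r); (seg p r, seg q r)].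
Proof. by move=> *; rewrite /= !eqxx (seg_arrow tri) // seg_arrow2. Qed.

Lemma tri_walk_rot p q r : p < q -> q < r -> r < p + n -> edg p q -> edg p r -> edg q r ->
  walk sig (seg p r) [:: (seg p r, seg q r); (seg q r, seg p q)].
Proof.
move=> pq qr rp e1 e2 e3; rewrite /= !eqxx seg_arrow2 //.
have e1' : edg q (p + n) by rewrite edgDr edgC.
have e2' : edg r (p + n) by rewrite edgDr edgC.
have := @seg_arrow _ _ _ tri q r (p + n) qr rp ltac:(lia) e3 e1' e2'.
by rewrite segDr (segC _ q p) => ->.
Qed.

Lemma EV_dW a c d : rel_arrow sig a -> EV c d (dW K sig a) = 0%R.
Proof.
case/rel_arrowP => p [q [r [pq qr rp -> [e1 e2 e3 hd]]]].
rewrite dW_eq // -cat1s /EV lin_cat -!/(EV _ _ _).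
rewrite (EV_weq _ _ _ (weq_tri_rot pq qr rp e1 e2 e3)); last exact: tri_walk_rot.
by rewrite /EV !lin1 scale1r scaleN1r subrr.
Qed.

Lemma EV_eqJ c d u v : eqJ u v -> EV c d u = EV c d v.
Proof.
move=> h; apply/eqP; rewrite -subr_eq0 -EV_sub; apply/eqP.
by apply: EV_inJ h => *; apply: EV_dW.
Qed.

Lemma dW_inJ p q r : p < q -> q < r -> r < p + n -> edg p q -> edg p r -> edg q r ->
  has_diag sig (vtx p) ->
  eqJ [:: (1%R, seg p r :: map snd [:: (seg p r, seg q r); (seg q r, seg p q)])]
      [:: (1%R, seg p r :: map snd (fan p r (p + n.-1) ++ turn p ++ fan p p.+1 q))].
Proof.
move=> pq qr rp e1 e2 e3 hd; apply/inJP.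
exists [:: ((idem K (seg p r), (seg p q, seg p r)), idem K (seg p q))]; split.
  rewrite /= /wfKQ /= !andbT; apply/and3P; split; [exact: e2| |exact: e1].
  by rewrite /rel_arrow /= seg_arrow // not_sides_has_diag.
move=> V g; rewrite big_seq1 /Jterm /= dW_eq // lin_sub !lin_mul !lin1 scale1r.
have w1 := tri_walk_rot pq qr rp e1 e2 e3.
have [h1 h2] := weq_walk tri (weq_tri_rot pq qr rp e1 e2 e3) (seg p r).
have := h2 w1; rewrite /wend /= => e.
rewrite lin_cons lin1 !pcomp_cons !eqxx !lin1 !pcomp_cons /= -e !eqxx.
by rewrite !cats0 !scale1r scaleN1r.
Qed.

Lemma valid_walk x (w : seq arr) : is_edge sig x -> walk sig x w -> valid_path sig (x :: map snd w).
Proof. by move=> ex hw; rewrite /= ex path_walk (walk_pairmap hw). Qed.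

(** This carries the combinatorial congruence over to Gamma. In a concatenation one factor is
    replaced at a time, the other serving as context for [eqJ_path]. *)
Lemma eqJ_weq x v w : weq v w -> is_edge sig x -> walk sig x v ->
  eqJ [:: (1%R, x :: map snd v)] [:: (1%R, x :: map snd w)].
Proof.
move=> h; elim: h x => {v w} [p q r pq qr rp e1 e2 e3|w|v w h IH|u v w h1 IH1 h2 IH2|u u' v v' h1 IH1 h2 IH2] x ex hw.
- have -> : x = seg p q by apply: walk_start hw (tri_walk pq qr rp e1 e2 e3).
  have e1' : edg q (p + n) by rewrite edgDr edgC.
  have e2' : edg r (p + n) by rewrite edgDr edgC.
  (* With a diagonal at P_q this is the derivative along [q,r] -> [q,p], that is [dW_inJ] for the
     triangle (q, r, p + n). Otherwise [turn q] is the left-hand side and both fans are empty. *)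
  case hd : (has_diag sig (vtx q)).
    have := dW_inJ qr rp (_ : p + n < q + n) e3 e1' e2' hd.
    by rewrite !segDr (segC _ q p) (segC _ r p); apply; lia.
  have := @not_sides_has_diag q r (p + n) qr rp ltac:(lia) e3 e1' e2'.
  rewrite hd !is_side_seg; try lia.
  move/negbFE => s; have [er ep] : r = q.+1 /\ p + n = q + n.-1 by lia.
  rewrite /turn hd -ep er !fan_nil cats0 /= !segDl.
  exact: eqJ_refl.
- exact: eqJ_refl.
- by apply: eqJ_sym; apply: IH => //; have [->] := weq_walk tri h x.
- by apply: eqJ_trans (IH1 _ ex hw) (IH2 _ ex _); have [<-] := weq_walk tri h1 x.
- move: hw; rewrite walk_cat => /andP[hu hv].
  have [wu wv] := weq_walk tri h1 x; have {}wv := wv hu.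
  have eu := wend_edge ex hu.
  apply: (@eqJ_trans _ _ _ _ [:: (1%R, x :: map snd (u' ++ v))]).
    rewrite !map_cat; apply: (@eqJ_path _ _ _ x x _ _ [::]) => //.
    + by rewrite /= ex.
    + exact: valid_walk.
    + exact: IH1.
  have h3 := @eqJ_path K n sig (wend x u') x (map snd v) (map snd v') (map snd u') [::].
  rewrite !cats0 in h3; rewrite !map_cat; apply: h3 => //.
  + by apply: valid_walk; rewrite -?wu.
  + rewrite -/(wend _ _) -wv; have := wend_edge eu hv; by rewrite /= andbT.
  + by rewrite -wv -!/(wend _ _); have [_ ->] := weq_walk tri h2 (wend x u).
  + by rewrite -wv; apply: IH2.
Qed.

Definition cwt (c : seq (edge n)) := if c is x :: s then wt (pairmap pair x (rcons s x)) else 0.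

Lemma cwt_rot k c : cwt (rot k c) = cwt c.
Proof.
elim: k => [|k IH]; first by rewrite rot0.
have [h|h] := ltnP k (size c); last by rewrite rot_oversize // ltnW.
rewrite -add1n rotD // -IH; case: (rot k c) => [|x [|y s]] //.
rewrite rot1_cons /= wt_cons -!cats1 !pairmap_cat /= !wt_cat.
by rewrite !wt_cons wt_nil cats1 last_rcons; lia.
Qed.

Lemma min_cycle_closed c : c \in tri_cycles sig ++ big_cycles sig ->
  cycle (arrow sig) c /\ cwt c = 1.
Proof.
rewrite mem_cat => /orP[/mapP[[[x y] z]]|/mapP[p]]; rewrite mem_enum.
  move=> /= /andP[/andP[/= xy yz]] /and5P[_ _ _ e1 /andP[e2 e3]] ->.
  have xz := ltn_trans xy yz.
  have zx : z < x + n by have := ltn_ord z; lia.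
  have v (i : 'I_n) : vtx i = i := vtx_ord n_gt2 i.
  have sE (i j : 'I_n) : mkE i j = seg i j by rewrite /seg !v.
  split; last first.
    by rewrite /= /mkE xy xz yz !wt_cons wt_nil /wt1 /=; lia.
  have := @tri_walk x y z xy yz zx; have := @tri_walk_rot x y z xy yz zx.
  rewrite /edg -!sE e1 e2 e3 /= !eqxx /= !andbT => h1 h2.
  have /andP[-> ->] := h2 isT isT isT; have /andP[_ ->] := h1 isT isT isT.
  by [].
rewrite inE => hd ->; rewrite -(vtx_ord n_gt2 p) big_cycle_vtx.
have e := edg_side sig n_gt2 p.
have b : p.+1 < p + n by lia.
have [h1 _] := walk_cyc tri (ltnSn p) b e.
have E : rcons (map snd (fan p p.+1 (p + n.-1))) (seg p p.+1) = map snd (cyc sig n_gt2 p p.+1).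
  by rewrite /cyc fan_nil cats0 map_cat /turn vtx_ord hd cats1.
by rewrite /cwt /cycle E path_walk (walk_pairmap h1) (wt_cyc (ltnSn p) b e) h1.
Qed.

Lemma min_cycle_path i m : m \in min_cycles_at sig i -> exists s,
  [/\ m = i :: s, valid_path sig m, last i s = i & wt (pairmap pair i s) = 1].
Proof.
case/flattenP => _ /mapP[c hc ->] /mapP[k]; rewrite mem_filter mem_iota add0n => /andP[/eqP ik kc] ->.
have [h1 h2] := min_cycle_closed hc.
move: h1 h2; rewrite -(rot_cycle k) -(cwt_rot k).
rewrite /rot (drop_nth i) // ik; set s := _ ++ _; exists (rcons (behead s) i).
move: h1 h2; rewrite /s /= => h1 h2; split; rewrite ?last_rcons ?cats1 //=.
rewrite h1 andbT; move: h1; rewrite rcons_path /=.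
by case: (drop _ _ ++ _) => [|y t] /=; [|move=> /andP[/andP[] ]] => /arrow_edges[].
Qed.

End JacobianRelations.

(** * Paths starting at a side, up to equivalence *)

Section SideIdempotents.
Variables (n : nat) (sig : {set edge n}) (n_gt2 : 2 < n).
Notation vtx := (vtx n_gt2).
Notation seg := (seg n_gt2).
Notation edg := (edg sig n_gt2).
Notation can := (can sig n_gt2).
Notation arr := (edge n * edge n)%type.
Hypothesis tri : triangulation sig.

Definition sideE (i : 'I_n) : edge n := seg i i.+1.
(* The lightest walk from sideE i to e has weight dN e i - closing i: the correction is 1 for the
   side [P_n, P_1], whose second label i + 1 = n already lies past the base point. *)
Definition closing (i : 'I_n) : nat := (i.+1 == n :> nat).
Definition dN (e : edge n) (i : 'I_n) : nat := (e.1 < i) + (e.2 < i).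

Lemma sideE_val (i : 'I_n) :
  (val (sideE i).1, val (sideE i).2) = if i.+1 == n then (0, n.-1) else (val i, i.+1).
Proof.
have h := ltn_ord i; rewrite /sideE seg1E seg2E.
have v1 : vtx i = i :> nat by rewrite vtx_ord.
have v2 := @val_vtx n n_gt2 i.+1 ltac:(lia).
move: (vtx i) (vtx i.+1) v1 v2 => x y /= v1 v2.
case: eqP => c /=; case: ifP v2 => c' v2; try lia; case: ifP => c''; congr pair; lia.
Qed.

Lemma is_side_sideE i : is_side (sideE i).
Proof. by rewrite /sideE is_side_seg ?eqxx //; lia. Qed.

Lemma is_edge_sideE i : is_edge sig (sideE i).
Proof. by rewrite /is_edge is_side_sideE. Qed.

Lemma sideE_inj : injective sideE.
Proof.
move=> i j e; have := sideE_val i; rewrite e sideE_val.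
have := ltn_ord i; have := ltn_ord j => hj hi h; apply: val_inj => /=.
have := congr1 snd h; have := congr1 fst h.
by case: eqP => /= c1; case: eqP => /= c2; lia.
Qed.

Lemma is_sideP e : is_side e -> exists i, e = sideE i.
Proof.
case: e => x y; rewrite /is_side /= => /andP[xy h].
have E i : (val (sideE i).1, val (sideE i).2) = (val x, val y) -> (x, y) = sideE i.
  by rewrite [sideE i]surjective_pairing => -[/val_inj-> /val_inj->].
case: (altP (y =P x.+1 :> nat)) h => [yx _|_ /= /andP[/eqP x0 /eqP yn]].
  have c : (x.+1 == n) = false by apply/eqP; have := ltn_ord y; lia.
  by exists x; apply: E; rewrite sideE_val c /= yx.
exists y; apply: E; rewrite sideE_val /= x0 yn prednK ?eqxx //; lia.
Qed.

Lemma edge_window i e : i < n -> is_edge sig e -> exists s t, in_window sig n_gt2 i s t /\ e = seg s t.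
Proof.
move=> i_n /(edge_seg n_gt2 tri)[es lt _ ed]; have := ltn_ord e.1; have := ltn_ord e.2 => h2 h1.
have [c|c] := leqP i e.1.
  by exists e.1, e.2; split=> //; split=> //; lia.
have [c'|c'] := leqP i e.2.
  exists e.2, (e.1 + n); split; last by rewrite segDr segC -es.
  by split; try lia; rewrite edgDr edgC.
exists (e.1 + n), (e.2 + n); rewrite segDr segDl; split; last exact: es.
by split; try lia; rewrite edgDr edgDl.
Qed.

(** All labels are below 2n, so a quotient is 1 exactly for an end lifted past the base point, that
    is, one whose vertex precedes i. The starting side contributes [closing i]. *)
Lemma wt_can_dN (i : 'I_n) s t : in_window sig n_gt2 i s t ->
  wt (can i s t) + closing i = dN (seg s t) i.
Proof.
move=> [h1 h2 h3 e]; have := wt_can h1 h2 h3 e.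
have dc x : x < n + n -> x %/ n = ~~ (x < n).
  move=> xn; case: ltnP => c'; first by rewrite divn_small.
  by rewrite -(subnK c') divnDr // divnn (n_gt0 n_gt2) divn_small //; lia.
have hi := ltn_ord i; rewrite !dc /closing /dN; try lia.
rewrite hi seg1E seg2E => eq.
have v1 := @val_vtx n n_gt2 s ltac:(lia); have v2 := @val_vtx n n_gt2 t ltac:(lia).
move: (vtx s) (vtx t) v1 v2 => x y /= v1 v2.
by case: ifP v1; case: ifP v2; case: ifP; lia.
Qed.

(** Together with [exists_walk] this gives all weights of walks from a side to e. The correction is
    added on the left to avoid truncated subtraction. *)
Lemma walk_weight (i : 'I_n) w : walk sig (sideE i) w ->
  exists k, wt w + closing i = dN (wend (sideE i) w) i + k.
Proof.
move=> hw; have [s [t [k [win e eqw]]]] := normal_form tri (ltn_ord i) hw.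
exists k; rewrite (weq_wt eqw) wt_cat wpow_wt e -(wt_can_dN win).
by case: win => *; rewrite wt_ecyc //; lia.
Qed.

Lemma exists_walk (i : 'I_n) e k : is_edge sig e -> exists w,
  [/\ walk sig (sideE i) w, wend (sideE i) w = e & wt w + closing i = dN e i + k].
Proof.
move=> he; have [s [t [win e_st]]] := edge_window (ltn_ord i) he.
have [h1 h2 h3 h4] := win; have [w1 w2] := walk_can tri h1 h2 h3 h4.
have [c1 c2] := walk_ecyc n_gt2 tri he; have [c3 c4] := walk_wpow k c1 c2.
exists (can i s t ++ wpow (ecyc sig n_gt2 e) k).
rewrite walk_cat wend_cat w1 w2 -e_st c3 c4 wt_cat wpow_wt wt_ecyc //.
by split=> //; have := wt_can_dN win; rewrite -e_st; lia.
Qed.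

End SideIdempotents.

(** * Separating and realising elements by their polynomials *)

Section Evaluation.
Local Open Scope ring_scope.
Variables (K : fieldType) (n : nat) (sig : {set edge n}) (n_gt2 : (2 < n)%N).
Notation sideE := (sideE n_gt2).
Notation KQ := (KQ K n).
Notation eqJ := (@eqJ K n sig).
Notation wfKQ := (@wfKQ K n sig).
Hypothesis tri : triangulation sig.

Implicit Types (a b v e : edge n) (u : KQ).

Definition sided (u : KQ) : bool := all (fun c => if c.2 is x :: _ then is_side x else false) u.

Lemma sided_mul u (v : KQ) : sided u -> sided (mulKQ u v).
Proof.
move=> hu; apply: (@mulKQ_all _ _ (fun p => if p is x :: _ then is_side x else false) predT
  (fun p => if p is x :: _ then is_side x else false)) hu _ => //.
  by case.
exact/allP.
Qed.

Lemma sided_eF : sided (eF K n).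
Proof. by apply/allP => c /mapP[v]; rewrite mem_enum => hv ->. Qed.

Lemma wf_eF : wfKQ (eF K n).
Proof.
by apply/allP => c /mapP[v]; rewrite mem_enum => hv -> /=; rewrite andbT /is_edge; apply/orP; left.
Qed.

Lemma EV_eF a b : EV a b (eF K n) = ((a == b) && is_side a)%:R.
Proof.
rewrite /EV /lin big_map big_enum /=.
under eq_bigr do rewrite mono_cons /= wt_nil expr0 scale1r.
rewrite big_mkcond (bigD1 a) //= eqxx /= big1 ?addr0 => [|x nx].
  by rewrite unfold_in /=; case: ifP; case: eqP.
by rewrite (negbTE nx) if_same.
Qed.

Lemma EV_idem a b v : EV a b (idem K v) = ((a == v) && (b == v))%:R.
Proof.
rewrite EV_path /= wt_nil expr0 scale1r ![v == _]eq_sym.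
by case: ifP.
Qed.

Lemma EV_eFl (i : 'I_n) b u : nonnil u -> EV (sideE i) b (mulKQ (eF K n) u) = EV (sideE i) b u.
Proof.
move=> pu; rewrite EV_mul ?(wf_nonnil wf_eF) // (bigD1 (sideE i)) //= big1 ?addr0.
  by rewrite EV_eF eqxx is_side_sideE mul1r.
by move=> x nx; rewrite EV_eF eq_sym (negbTE nx) mul0r.
Qed.

Lemma EV_eFr a b u : nonnil u -> EV a b (mulKQ u (eF K n)) = if is_side b then EV a b u else 0.
Proof.
move=> pu; rewrite EV_mul ?(wf_nonnil wf_eF) // (bigD1 b) //= big1 ?addr0.
  by rewrite EV_eF eqxx; case: ifP; rewrite ?mulr1 ?mulr0.
by move=> x nx; rewrite EV_eF (negbTE nx) mulr0.
Qed.

Lemma EV_idemr a b v u : nonnil u -> EV a b (mulKQ u (idem K v)) = if b == v then EV a b u else 0.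
Proof.
move=> pu; rewrite EV_mul // (bigD1 v) //= big1 ?addr0.
  by rewrite EV_idem eqxx; case: eqP => [->|]; rewrite ?mulr1 ?mulr0.
by move=> x nx; rewrite EV_idem (negbTE nx) mulr0.
Qed.

(** Start, end and weight: a complete invariant modulo J for paths starting at a side. *)
Definition pclass (p : seq (edge n)) := (ohead p, last None (map Some p), pwt p).

Lemma eqJ_pclass p q : valid_path sig p -> valid_path sig q ->
  (if p is x :: _ then is_side x else false) -> pclass p = pclass q ->
  eqJ [:: (1, p)] [:: (1, q)].
Proof.
case: p q => [|x s] // [|y t] //= /andP[ex ps] /andP[_ pt] sx.
rewrite /pclass /= !last_map => -[exy el ew]; subst y.
have [i ei] := is_sideP n_gt2 sx.
rewrite !path_walk in ps pt; rewrite -(map_snd_pairmap x s) -(map_snd_pairmap x t).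
apply: eqJ_weq => //; rewrite ei in ps pt el *.
apply: (weq_of_wt tri (ltn_ord i)) => //.
  by rewrite /wend !map_snd_pairmap.
by rewrite -ei.
Qed.

(** In the difference, every path may be replaced modulo J by one chosen path of its class. The
    total coefficient of a class is a coefficient of some [EV], hence zero, so nothing remains. *)
Lemma eqJ_of_EV u (v : KQ) : wfKQ u -> wfKQ v -> sided u -> sided v ->
  (forall i e, EV (sideE i) e u = EV (sideE i) e v) -> eqJ u v.
Proof.
move=> wu wv su sv h; rewrite /Defs.eqJ; set w := subKQ u v.
have ww : wfKQ w by rewrite /w wf_cat wu wf_scale.
have sw : sided w by rewrite /sided all_cat all_map; apply/andP; split; [exact: su|exact: sv].
have hw i e : EV (sideE i) e w = 0 by rewrite EV_sub h subrr.
have cl0 t : \sum_(c <- w | pclass c.2 == t) c.1 = 0.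
  case: t => [[oa ob] m].
  have z (P : (option (edge n) * option (edge n) * nat)) :
      (forall c, c \in w -> pclass c.2 != P) -> \sum_(c <- w | pclass c.2 == P) c.1 = 0.
    by move=> hP; rewrite big_seq_cond big1 // => c /andP[/hP/negbTE->].
  have H c : c \in w -> exists i s, c.2 = sideE i :: s.
    move=> cw; have := allP sw _ cw; case: c.2 => [|x s] // /(is_sideP n_gt2)[i ->].
    by exists i, s.
  case: oa => [a|]; last first.
    by apply: z => c /H[i [s ->]]; apply/eqP.
  case: ob => [b|]; last first.
    by apply: z => c /H[i [s ->]]; rewrite /pclass /= last_map; apply/eqP.
  case ha : (is_side a); last first.
    apply: z => c /H[i [s ->]]; apply/eqP => -[ea _ _].
    by rewrite -ea is_side_sideE in ha.
  have [i ei] := is_sideP n_gt2 ha.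
  transitivity ((EV (sideE i) b w)`_m); last by rewrite hw coef0.
  rewrite /EV /lin coef_sum big_mkcond; apply: eq_bigr => c _.
  rewrite coefZ /mono /pclass !xpair_eqE -ei.
  case: (ohead _ == _); case: (last _ _ == _) => /=; rewrite ?coef0 ?mulr0 //.
  by rewrite coefXn (eq_sym m); case: eqP; rewrite ?mulr1 ?mulr0.
(* A path of class t occurring in [w]; the default [[::]] is never reached for the class of a term
   of [w]. *)
pose rep t := head [::] [seq c.2 | c <- w & pclass c.2 == t].
have rep_in c : c \in w -> exists2 d, d \in w & rep (pclass c.2) = d.2 /\ pclass d.2 = pclass c.2.
  move=> cw; rewrite /rep; case e : [seq _ <- w | _] => [|d s].
    by have : c \in [seq d <- w | pclass d.2 == pclass c.2] by [rewrite mem_filter eqxx]; rewrite e.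
  have : d \in [seq d <- w | pclass d.2 == pclass c.2] by rewrite e mem_head.
  by rewrite mem_filter => /andP[/eqP e1 dw]; exists d.
have hJ : inJ sig (flatten [seq scaleKQ c.1 (subKQ [:: (1, c.2)] [:: (1, rep (pclass c.2))]) | c <- w]).
  apply: inJ_flatten => c cw; apply: inJ_scale.
  have [d dw [-> ed]] := rep_in c cw.
  apply: eqJ_pclass; rewrite ?ed //; first exact: (allP ww _ cw).
    exact: (allP ww _ dw).
  exact: (allP sw _ cw).
apply: inJ_lin hJ => V g; rewrite lin_flatten.
under [RHS]eq_bigr do rewrite lin_scale lin_sub !lin1 !scale1r scalerBr.
rewrite sumrB [X in _ - X](_ : _ = 0) ?subr0 //.
by apply: (@big_class K n _ V pclass (fun t => g (rep t))).
Qed.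

Lemma EV_div i e u : wfKQ u -> exists q : {poly K}, EV (sideE i) e u * 'X^(closing i) = q * 'X^(dN e i).
Proof.
elim: u => [|[k p] u IH] /=.
  by exists 0; rewrite /EV lin_nil !mul0r.
case/andP=> vp /IH[q hq].
suff [q' hq'] : exists q' : {poly K}, mono K (sideE i) e p * 'X^(closing i) = q' * 'X^(dN e i).
  by exists (k *: q' + q); rewrite /EV lin_cons !mulrDl -hq /= -!scalerAl hq'.
case: p vp => [|x s] //= /andP[ex ps]; rewrite mono_cons.
case: ifP => [/andP[/eqP ex' /eqP <-]|]; last by exists 0; rewrite !mul0r.
rewrite path_walk ex' in ps; have [m hm] := walk_weight tri ps.
exists 'X^m; rewrite -!exprD ex' hm /wend map_snd_pairmap; congr ('X^_); lia.
Qed.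

Lemma exists_EV_single i e (P q : {poly K}) : is_edge sig e -> P * 'X^(closing i) = q * 'X^(dN e i) ->
  exists u, [/\ wfKQ u, sided u & forall i' e', EV (sideE i') e' u =
     if (i' == i) && (e' == e) then P else 0].
Proof.
move=> he hP.
have /fin_all_exists[w hw] (m : 'I_(size q)) := exists_walk n_gt2 tri i m he.
(* The coefficient of x^m in q goes to the walk exceeding the least possible weight by m. *)
exists [seq (q`_m, sideE i :: map snd (w m)) | m : 'I_(size q)]; split.
- apply/allP => c /mapP[m _ ->]; have [h1 _ _] := hw m.
  by apply: valid_walk => //; apply: is_edge_sideE.
- by apply/allP => c /mapP[m _ ->]; apply: is_side_sideE.
move=> i' e'; rewrite /EV /lin big_map big_enum /=.
under eq_bigr => m _ do
  rewrite mono_cons (inj_eq (@sideE_inj _ n_gt2)) -/(wend _ _) (let: And3 _ h _ := hw m in h)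
    (let: And3 h _ _ := hw m in walk_pairmap h) (eq_sym i) (eq_sym e).
case: ifP => _; last by rewrite big1 // => m _; rewrite scaler0.
apply: (@mulIf _ 'X^(closing i)); first by rewrite monic_neq0 ?monicXn.
rewrite hP mulr_suml -[q in RHS]coefK poly_def mulr_suml; apply: eq_bigr => m _.
rewrite -!scalerAl -!exprD; have [_ _ ->] := hw m; congr (_ *: 'X^_); lia.
Qed.

Lemma exists_EV (P : 'I_n -> edge n -> {poly K}) :
  (forall i e, is_edge sig e -> exists q : {poly K}, P i e * 'X^(closing i) = q * 'X^(dN e i)) ->
  (forall i e, ~~ is_edge sig e -> P i e = 0) ->
  exists u, [/\ wfKQ u, sided u & forall i e, EV (sideE i) e u = P i e].
Proof.
move=> h1 h2.
have /fin_all_exists[F hF] (x : 'I_n * edge n) : exists u, [/\ wfKQ u, sided u &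
    forall i' e', EV (sideE i') e' u = if (i' == x.1) && (e' == x.2) then P x.1 x.2 else 0].
  have [he|he] := boolP (is_edge sig x.2).
    by have [q hq] := h1 x.1 _ he; apply: exists_EV_single hq.
  by exists [::]; split=> // i' e'; rewrite (h2 _ _ he) if_same /EV lin_nil.
exists (flatten [seq F x | x : 'I_n * edge n]); split.
- by apply/allP => c /flattenP[s /mapP[x _ ->]]; have [/allP h _ _] := hF x; apply: h.
- by apply/allP => c /flattenP[s /mapP[x _ ->]]; have [_ /allP h _] := hF x; apply: h.
move=> i e; rewrite /EV lin_flatten big_enum /= (bigD1 (i, e)) //= big1 ?addr0.
  by have [_ _ h] := hF (i, e); rewrite -/(EV _ _ _) h /= !eqxx.
move=> [i' e'] ne; have [_ _ h] := hF (i', e'); rewrite -/(EV _ _ _) h /=.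
by move: ne; rewrite xpair_eqE (eq_sym i) (eq_sym e) => /negbTE->.
Qed.

End Evaluation.

(** * The tiled order and its modules *)

Local Open Scope ring_scope.

(** The conjugating factors of the summation index cancel in a matrix product. *)
Lemma mulf_cancel (F : fieldType) (p q a b c : F) : b != 0 ->
  p * q * a / c = (p * a / b) * (q * b / c).
Proof. by move=> hb; rewrite !mulrA (mulrAC _ q b) divfK // (mulrAC p). Qed.

Section TiledOrder.
Variables (K : fieldType) (n : nat) (sig : {set edge n}) (n_gt2 : (2 < n)%N).
Notation sideE := (sideE n_gt2).
Notation KQ := (KQ K n).
Notation Kx := (Kx K).
Notation toKx := (@toKx K).
Notation xKx := (xKx K).
Notation eqJ := (@eqJ K n sig).
Notation wfKQ := (@wfKQ K n sig).
Hypothesis tri : triangulation sig.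
Implicit Types (e : edge n) (u v : KQ) (A : 'M[Kx]_n).

Lemma toKxM : {morph toKx : p q / p * q}. Proof. exact: tofracM. Qed.
Lemma toKxD : {morph toKx : p q / p + q}. Proof. exact: tofracD. Qed.
Lemma toKx0 : toKx 0 = 0. Proof. exact: tofrac0. Qed.
Lemma toKx1 : toKx 1 = 1. Proof. exact: tofrac1. Qed.
Lemma toKx_inj : injective toKx.
Proof. by move=> p q /eqP; rewrite tofrac_eq => /eqP. Qed.
Lemma toKxXn k : toKx 'X^k = xKx ^+ k.
Proof. exact: tofracXn. Qed.
Lemma toKx_sum (I : finType) (F : I -> {poly K}) : toKx (\sum_i F i) = \sum_i toKx (F i).
Proof. exact: (rmorph_sum (@tofrac {poly K})). Qed.

Lemma xKx_neq0 : xKx != 0.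
Proof. by rewrite /Defs.xKx /Defs.toKx tofrac_eq0 polyX_eq0. Qed.
Lemma xKxn_neq0 k : xKx ^+ k != 0.
Proof. by rewrite expf_neq0 // xKx_neq0. Qed.

Lemma dexpE e i : (e.1 < e.2)%N -> dexp e.1 e.2 i = (dN e i)%:Z.
Proof. by rewrite /dexp /dN => h; do ?case: ifP; lia. Qed.

(** The columns of Lambda are the modules attached to the sides: column l is (l,l+1) for l < n,
    while column n is (1,n) divided by x. This division is the subtracted [closing l]. *)
Lemma cexpE i l : cexp i l = (dN (sideE l) i)%:Z - (closing l)%:Z.
Proof.
have := ltn_ord i; have := ltn_ord l => hl hi.
have := sideE_val n_gt2 l; rewrite /cexp /dN /closing.
case c : (l.+1 == n); case: (sideE l) => x y /= h; have := congr1 fst h; have := congr1 snd h.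
  by move=> /= -> ->; do ?case: ifP; lia.
by move=> /= -> ->; do ?case: ifP; lia.
Qed.

(** Keeps the subtraction [dN e i - closing i] from truncating: [closing i] is nonzero only for the
    last vertex, and every edge has an end before it. *)
Lemma closing_le_dN i e : is_edge sig e -> (closing i <= dN e i)%N.
Proof.
move=> he; have := edge_ltn tri he; have := ltn_ord e.2; rewrite /closing /dN.
by case: eqP; lia.
Qed.

(** Conjugation by diag(x^(closing i)) changes the lowest exponent dN - closing i of a row into dN -
    closing l, which is [cexp i l]. *)
Definition entry (i l : 'I_n) u : Kx :=
  toKx (EV (sideE i) (sideE l) u) * xKx ^+ closing i / xKx ^+ closing l.

Lemma entry_inj i l u v : entry i l u = entry i l v ->
  EV (sideE i) (sideE l) u = EV (sideE i) (sideE l) v.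
Proof.
move=> h; apply: toKx_inj; apply: (mulIf (xKxn_neq0 (closing i))).
by apply: (mulIf (invr_neq0 (xKxn_neq0 (closing l)))).
Qed.

Lemma xKx_cexp i l : xKx ^ cexp i l = xKx ^+ dN (sideE l) i / xKx ^+ closing l.
Proof. by rewrite cexpE expfzDr ?xKx_neq0 // -exprnN. Qed.

Lemma inLam_entry u : wfKQ u -> inLam (\matrix_(i, l) entry i l u).
Proof.
move=> wu i l; have [q hq] := EV_div n_gt2 tri i (sideE l) wu.
by exists q; rewrite mxE /entry xKx_cexp mulrA -!toKxXn -!toKxM hq.
Qed.

Definition vanishes u := forall i e, ~~ is_side e -> EV (sideE i) e u = 0.

(** Lifts of A to e_F Gamma e_F: [sided] is the condition on the left, and [vanishes] the one on the
    right, imposed only on polynomials because it is needed only modulo J. *)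
Definition represents A u :=
  [/\ wfKQ u, sided u, vanishes u & forall i l, entry i l u = A i l].

Lemma exists_represents A : inLam A -> exists u, represents A u.
Proof.
move=> hA.
have /fin_all_exists[P hP] (x : 'I_n * edge n) : exists p : {poly K},
    [/\ forall l, x.2 = sideE l -> toKx p * xKx ^+ closing x.1 / xKx ^+ closing l = A x.1 l,
        ~~ is_side x.2 -> p = 0 &
        exists q : {poly K}, p * 'X^(closing x.1) = q * 'X^(dN x.2 x.1)].
  case: x => i e /=; have [/(is_sideP n_gt2)[l ->]|ns] := boolP (is_side e); last first.
    exists 0; split=> // [l el|]; last by exists 0; rewrite !mul0r.
    by rewrite el is_side_sideE in ns.
  have [p hp] := hA i l; exists (p * 'X^(dN (sideE l) i - closing i)).
  have E : p * 'X^(dN (sideE l) i - closing i) * 'X^(closing i) = p * 'X^(dN (sideE l) i).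
    by rewrite -mulrA -exprD subnK // closing_le_dN // is_edge_sideE.
  split=> //; last by exists p.
  move=> l' /sideE_inj <-.
  by rewrite -!toKxXn -toKxM E toKxM !toKxXn hp xKx_cexp mulrA.
have [||u [w1 w2 w3]] := @exists_EV K _ sig n_gt2 tri (fun i e => P (i, e)).
- by move=> i e _; have [_ _] := hP (i, e).
- move=> i e; rewrite /is_edge negb_or => /andP[ns _].
  by have [_ ->] := hP (i, e).
exists u; split=> // [i e ns|i l]; first by rewrite w3; have [_ ->] := hP (i, e).
by rewrite /entry w3; have [-> ] := hP (i, sideE l).
Qed.

(** There is no preferred lift, so one is chosen; any two agree modulo J by [eqJ_represents].
    Outside Lambda the value is arbitrary. *)
Definition psi A : KQ :=
  ClassicalEpsilon.epsilon (inhabits ([::] : KQ)) (represents A).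

Lemma psi_represents A : inLam A -> represents A (psi A).
Proof. by move=> hA; apply: ClassicalEpsilon.epsilon_spec; apply: exists_represents. Qed.

Lemma eqJ_represents A u v : represents A u -> represents A v -> eqJ u v.
Proof.
move=> [u1 u2 u3 u4] [v1 v2 v3 v4]; apply: (@eqJ_of_EV _ _ _ n_gt2 tri) => // i e.
have [/(is_sideP n_gt2)[l ->]|ns] := boolP (is_side e); last by rewrite u3 ?v3.
by apply: entry_inj; rewrite u4 v4.
Qed.

Lemma represents_inLam A u : represents A u -> inLam A.
Proof.
move=> [u1 _ _ u4]; have := inLam_entry u1; congr inLam.
by apply/matrixP => i l; rewrite mxE u4.
Qed.

Lemma psi_eqJ A u : represents A u -> eqJ (psi A) u.
Proof.
move=> h; apply: eqJ_represents (h).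
by apply: psi_represents; apply: represents_inLam h.
Qed.

Lemma sum_sides (V : nmodType) (F : edge n -> V) : (forall e, ~~ is_side e -> F e = 0) ->
  \sum_e F e = \sum_l F (sideE l).
Proof.
move=> h; transitivity (\sum_e \sum_(l | sideE l == e) F e).
  apply: eq_bigr => e _; have [/(is_sideP n_gt2)[l ->]|ns] := boolP (is_side e).
    by rewrite (big_pred1 l) // => l'; rewrite (inj_eq (@sideE_inj _ n_gt2)).
  by rewrite big1 ?h.
rewrite (exchange_big_dep predT) //=; apply: eq_bigr => l _.
by rewrite (big_pred1 (sideE l)) // => e; rewrite eq_sym.
Qed.

Lemma represents_add A B u v : represents A u -> represents B v ->
  represents (A + B) (addKQ u v).
Proof.
move=> [u1 u2 u3 u4] [v1 v2 v3 v4]; split=> [|||i l].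
- by rewrite wf_cat u1.
- by rewrite /sided all_cat; apply/andP.
- by move=> i e ns; rewrite EV_add u3 ?v3 ?addr0.
- by rewrite mxE -u4 -v4 /entry EV_add toKxD !mulrDl.
Qed.

Lemma represents_mul A B u v : represents A u -> represents B v ->
  represents (A *m B) (mulKQ u v).
Proof.
move=> [u1 u2 u3 u4] [v1 v2 v3 v4].
have nu := wf_nonnil u1; have nv := wf_nonnil v1.
have E i e : EV (sideE i) e (mulKQ u v) =
    \sum_l EV (sideE i) (sideE l) u * EV (sideE l) e v.
  by rewrite EV_mul // sum_sides // => c ns; rewrite u3 // mul0r.
split=> [|||i l].
- exact: wf_mul.
- exact: sided_mul.
- by move=> i e ns; rewrite E big1 // => l _; rewrite v3 // mulr0.
- rewrite mxE /entry E toKx_sum !mulr_suml; apply: eq_bigr => k _.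
  by rewrite -u4 -v4 /entry toKxM; apply: mulf_cancel; apply: xKxn_neq0.
Qed.

Lemma represents_scale A u k : represents A u -> represents (toKx k%:P *: A) (scaleKQ k u).
Proof.
move=> [u1 u2 u3 u4]; split=> [|||i l].
- exact: wf_scale.
- by rewrite /sided all_map; exact: u2.
- by move=> i e ns; rewrite EV_scale u3 // scaler0.
- by rewrite mxE -u4 /entry EV_scale -mul_polyC toKxM !mulrA.
Qed.

Lemma represents_1 : represents 1%:M (eF K n).
Proof.
split=> [|||i l].
- exact: wf_eF.
- exact: sided_eF.
- by move=> i e ns; rewrite EV_eF; case: eqP => [ie|//]; rewrite -ie is_side_sideE in ns.
- rewrite mxE /entry EV_eF (inj_eq (@sideE_inj _ n_gt2)) is_side_sideE andbT.
  by case: eqP => [->|_]; rewrite ?toKx1 ?toKx0 ?mul0r // mul1r divff ?xKxn_neq0.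
Qed.

Lemma represents_eF u : wfKQ u ->
  represents (\matrix_(i, l) entry i l u) (mulKQ (mulKQ (eF K n) u) (eF K n)).
Proof.
move=> wu; have nu := wf_nonnil wu; have nF := wf_nonnil (wf_eF K sig).
have nFu := nonnil_mul u nF; split=> [|||i l].
- by rewrite !wf_mul // wf_eF.
- by do 2!apply: sided_mul; exact: sided_eF.
- by move=> i e ns; rewrite EV_eFr // (negbTE ns).
- by rewrite mxE /entry EV_eFr // is_side_sideE EV_eFl.
Qed.

Lemma inLam_x : inLam (xKx *: 1%:M : 'M[Kx]_n).
Proof.
move=> i l; rewrite !mxE; case: eqP => [->|_]; last by exists 0; rewrite mulr0 toKx0 mul0r.
by exists 'X; rewrite /cexp leqnn ifF ?expr0z //; have := ltn_ord l; lia.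
Qed.

(** A minimal cycle has weight 1, so among starts at sides both elements have the single polynomial
    x, at the pair (i,i). *)
Lemma psi_x_idem (i : edge n) m : is_side i -> m \in min_cycles_at sig i ->
  eqJ (mulKQ (psi (xKx *: 1%:M)) (idem K i)) [:: (1, m)].
Proof.
move=> /[dup] si /(is_sideP n_gt2)[l il] hm.
have [s [em vm lm wm]] := min_cycle_path n_gt2 tri hm.
have [p1 p2 p3 p4] := psi_represents inLam_x.
apply: (@eqJ_of_EV _ _ _ n_gt2 tri).
- by apply: wf_mul => //; rewrite /Defs.wfKQ /= /is_edge si.
- by rewrite /Defs.wfKQ /= vm.
- exact: sided_mul.
- by rewrite /sided em /= si.
move=> a e; rewrite EV_idemr ?(wf_nonnil p1) // em EV_path lm wm expr1 scale1r (eq_sym i e).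
rewrite (eq_sym i) andbC; case: eqP => [->|_] //=.
rewrite il (inj_eq (@sideE_inj _ n_gt2)).
apply: toKx_inj; apply: (mulIf (xKxn_neq0 (closing a))).
apply: (mulIf (invr_neq0 (xKxn_neq0 (closing l)))).
rewrite -/(entry a l _) p4 !mxE; case: eqP => [->|_]; last by rewrite toKx0 !mul0r mulr0.
by rewrite mulr1 mulfK ?xKxn_neq0.
Qed.

Lemma psi_Rorder_iso : Rorder_iso sig psi.
Proof.
have pr := psi_represents; split.
- move=> A /pr h; have [w _ _ a] := h; split=> //.
  apply: eqJ_represents h _; have := represents_eF w; congr (represents _ _).
  by apply/matrixP => i l; rewrite mxE a.
- by move=> A B /pr hA /pr hB; apply: psi_eqJ; apply: represents_add.
- by move=> A B /pr hA /pr hB; apply: psi_eqJ; apply: represents_mul.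
- by apply: psi_eqJ; apply: represents_1.
split.
- by move=> k A /pr hA; apply: psi_eqJ; apply: represents_scale.
- by move=> i si m; apply: psi_x_idem.
- move=> A B /pr[_ _ _ hA] /pr[_ _ _ hB] h; apply/matrixP => i l.
  by rewrite -hA -hB /entry (EV_eqJ n_gt2 tri _ _ h).
- move=> u wu; have h := represents_eF wu.
  exists (\matrix_(i, l) entry i l u); first exact: inLam_entry.
  by apply: eqJ_sym; apply: psi_eqJ.
Qed.

(** * The modules e_F Gamma e_j *)

Section EdgeModule.
Variables (j : edge n) (hj : is_edge sig j).

(** The row part of the conjugation in [entry]; the end j is fixed, and without a column factor the
    exponents are those of (s,t). *)
Definition phi u : 'cV[Kx]_n := \col_i (toKx (EV (sideE i) j u) * xKx ^+ closing i).

Let wj : wfKQ (idem K j). Proof. by rewrite /Defs.wfKQ /= hj. Qed.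

Lemma EV_eFGe i e u : wfKQ u ->
  EV (sideE i) e (mulKQ (mulKQ (eF K n) u) (idem K j)) =
  if e == j then EV (sideE i) j u else 0.
Proof.
move=> wu; have nu := wf_nonnil wu; have nF := wf_nonnil (wf_eF K sig).
rewrite EV_idemr ?nonnil_mul // EV_eFl //.
by case: eqP => [->|].
Qed.

Lemma wf_eFGe u : wfKQ u -> wfKQ (mulKQ (mulKQ (eF K n) u) (idem K j)).
Proof. by move=> wu; rewrite !wf_mul ?wf_eF. Qed.

Lemma sided_eFGe u : sided (mulKQ (mulKQ (eF K n) u) (idem K j)).
Proof. by do 2!apply: sided_mul; exact: sided_eF. Qed.

Lemma phi_EV u v : phi u = phi v -> forall i, EV (sideE i) j u = EV (sideE i) j v.
Proof.
move=> h i; have := congr1 (fun w : 'cV[Kx]_n => w i 0) h; rewrite !mxE.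
by move/(mulIf (xKxn_neq0 (closing i)))/toKx_inj.
Qed.

Lemma phi_Lmod_iso : Lmod_iso sig psi j phi.
Proof.
have lt := edge_ltn tri hj; split.
- by move=> u v _ _ h; apply/matrixP => i l; rewrite !mxE (EV_eqJ n_gt2 tri _ _ h).
- move=> u [wu _] i; have [q hq] := EV_div n_gt2 tri i j wu.
  by exists q; rewrite mxE dexpE // -!toKxXn -!toKxM hq toKxM toKxXn.
- by move=> u v _ _; apply/matrixP => i l; rewrite !mxE EV_add toKxD mulrDl.
- move=> A u /psi_represents[p1 p2 p3 p4] [wu _]; apply/matrixP => i l.
  rewrite !mxE EV_mul ?(wf_nonnil p1) ?(wf_nonnil wu) // sum_sides; last by move=> c ns; rewrite p3 // mul0r.
  rewrite toKx_sum mulr_suml; apply: eq_bigr => k _.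
  rewrite mxE -p4 /entry toKxM -[LHS]divr1 -[X in _ = _ * X]divr1.
  by apply: mulf_cancel; apply: xKxn_neq0.
split.
- move=> u v [wu ju] [wv jv] /phi_EV h.
  (* Both elements are replaced by their cut-downs by e_F and e_j, for which all polynomials other
     than those ending at j vanish. *)
  apply: eqJ_trans ju _; apply: eqJ_sym; apply: eqJ_trans jv _; apply: eqJ_sym.
  apply: (@eqJ_of_EV _ _ _ n_gt2 tri); rewrite ?wf_eFGe ?sided_eFGe // => i e.
  by rewrite !EV_eFGe // h.
- move=> w hw.
  have /fin_all_exists[P hP] (i : 'I_n) : exists p : {poly K},
      toKx p * xKx ^+ closing i = w i 0 /\ exists q : {poly K}, p * 'X^(closing i) = q * 'X^(dN j i).
    (* Row i of [phi] multiplies by x^(closing i), so the required polynomial has that power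
       removed; [closing_le_dN] leaves a nonnegative exponent. *)
    have [p hp] := hw i; exists (p * 'X^(dN j i - closing i)).
    have E : p * 'X^(dN j i - closing i) * 'X^(closing i) = p * 'X^(dN j i).
      by rewrite -mulrA -exprD subnK // closing_le_dN.
    by split; [rewrite -toKxXn -toKxM E hp dexpE // toKxM toKxXn|exists p].
  have [||u [w1 w2 w3]] := @exists_EV K _ sig n_gt2 tri (fun i e => if e == j then P i else 0).
  + move=> i e _; case: eqP => [->|_]; last by exists 0; rewrite !mul0r.
    by have [] := hP i.
  + by move=> i e; case: eqP => [->|//]; rewrite hj.
  exists u.
    split=> //; apply: (@eqJ_of_EV _ _ _ n_gt2 tri); rewrite ?wf_eFGe ?sided_eFGe // => i e.
    by rewrite EV_eFGe // !w3 eqxx.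
  apply/matrixP => i l; rewrite !mxE ord1 w3 eqxx; by have [-> _] := hP i.
Qed.

End EdgeModule.
End TiledOrder.

Theorem theorem3p8 (K : fieldType) (n : nat) (sig : {set 'I_n * 'I_n}) :
  (3 <= n)%N -> triangulation sig ->
  exists psi : 'M[Kx K]_n -> KQ K n,
    Rorder_iso sig psi /\
    forall j : 'I_n * 'I_n, is_edge sig j ->
      exists phi : KQ K n -> 'cV[Kx K]_n, Lmod_iso sig psi j phi.
Proof.
move=> n_gt2 tri; exists (psi sig n_gt2); split; first exact: psi_Rorder_iso.
by move=> j hj; exists (phi n_gt2 j); apply: phi_Lmod_iso.
Qed.
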